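(* Let $\omega$ be a positive constant, and consider the 4-D isotropic oscillator $$\mathcal{H}_2=\tfrac12\,(Q_1^2+Q_2^2+Q_3^2+Q_4^2)+\tfrac12\,\omega^2\,(q_1^2+q_2^2+q_3^2+q_4^2).$$ By composing the three symplectic transformations $$(q,Q)\ \xrightarrow{\text{Projective Euler}}\ (\rho,\phi,\theta,\psi,P,\Phi,\Theta,\Psi)\ \xrightarrow{\text{Projective Andoyer}}\ (\rho,u_1,u_2,u_3,P,U_1,U_2,U_3)\ \xrightarrow{\text{Delaunay}}\ (\ell,u_1,g,u_3,L,U_1,G,U_3),$$ together with the regularization $ds=\frac{1}{4\rho}\,d\tau$, the Hamiltonian of the 4-D isotropic oscillator is given by $$\mathcal{H}_0=-\frac{\gamma^2}{2L^2}$$ in the manifold $\mathcal{H}_0=-\omega/8$.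
   Context: $\mathbb{R}^4\times\mathbb{R}^4$, with coordinates $(q,Q)$, carries the standard symplectic form $dQ\wedge dq$. All transformations are considered on the open domains where the charts below are defined. The regularization $ds=\frac{1}{4\rho}\,d\tau$ (Poincaré technique) means passing to the new Hamiltonian $(\mathcal{H}_2-h)/(4\rho)$, where $h$ is the value of $\mathcal{H}_2$ fixed by the initial conditions, its additive constant being absorbed in the value defining the manifold. The constant $\gamma$ is $\gamma=h/4$. Projective Euler variables $(\rho,\phi,\theta,\psi,P,\Phi,\Theta,\Psi)$: $$q_1=\sqrt{\rho}\,\sin\tfrac{\theta}{2}\cos\tfrac{\phi-\psi}{2},\quad q_2=\sqrt{\rho}\,\sin\tfrac{\theta}{2}\sin\tfrac{\phi-\psi}{2},\quad q_3=\sqrt{\rho}\,\cos\tfrac{\theta}{2}\sin\tfrac{\phi+\psi}{2},\quad q_4=\sqrt{\rho}\,\cos\tfrac{\theta}{2}\cos\tfrac{\phi+\psi}{2},$$ with $(\rho,\phi,\theta,\psi)\in\mathbb{R}^+\times[0,2\pi)\times(0,\pi)\times(-\frac{\pi}{2},\frac{\pi}{2})$ and momenta satisfying $\sum_i Q_i\,dq_i=P\,d\rho+\Theta\,d\theta+\Psi\,d\psi+\Phi\,d\phi$. Projective Andoyer variables $(\rho,u_1,u_2,u_3,P,U_1,U_2,U_3)$ are the symplectic variables obtained by keeping $(\rho,P)$ and transforming $(\phi,\theta,\psi,\Phi,\Theta,\Psi)$ to $(u_1,u_2,u_3,U_1,U_2,U_3)$, with $|U_1|<U_2$ and $|U_3|<U_2$,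 as follows. Put $c_1=U_1/U_2$, $c_2=U_3/U_2$, $s_i=\sqrt{1-c_i^2}$; then $$\cos\theta=c_1c_2+s_1s_2\cos u_2,\quad \sin(\psi-u_1)=\frac{\sin u_2}{\sin\theta}\,s_2,\quad \sin(\phi-u_3)=\frac{\sin u_2}{\sin\theta}\,s_1,$$ $$\Phi=U_3,\qquad \Psi=U_1,\qquad \Theta=U_2\sqrt{1-\frac{c_1^2+c_2^2-2c_1c_2\cos\theta}{\sin^2\theta}}.$$ Delaunay transformation $\mathcal{D}_\gamma$ between $(\ell,g,L,G)$ and $(\rho,u_2,P,U_2)$ (with $u_1,u_3,U_1,U_3$ unchanged): $$u_2=g+f,\qquad U_2=G,\qquad \rho=a(1-e\cos E),\qquad P=\frac{L\,e\sin E}{a(1-e\cos E)},$$ $$a=\frac{L^2}{\gamma},\qquad \eta=\frac{G}{L},\qquad e=\sqrt{1-\eta^2},$$ where the auxiliary angles $f,E$ are related to $\ell$ by $$\ell=E-e\sin E,\qquad \tan\frac f2=\sqrt{\frac{1+e}{1-e}}\,\tan\frac E2 .$$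
   Formalization: The value defining the manifold is corrected from −ω/8 to −ω²/8: with the displayed potential ½ω²|q|², the regularized Hamiltonian equals −γ²/(2L²)+ω²/8, so the printed value fails for every ω≠1 (for ω=2 one gets H0=−1/2, not −1/4). *)

(* Defs.v *)
From HB Require Import structures.
From mathcomp Require Import all_boot all_order all_algebra.
From mathcomp Require Import all_classical all_reals all_analysis.

Set Implicit Arguments.
Unset Strict Implicit.
Unset Printing Implicit Defensive.

Import Order.TTheory GRing.Theory Num.Theory.
Import numFieldNormedType.Exports.

Local Open Scope classical_set_scope.
Local Open Scope ring_scope.

(* A point of phase space is a pair (positions, momenta); the i-th momentum is
   conjugate to the i-th position.  The four systems of variables are listed as
     Cartesian            (q1, q2, q3, q4)      , (Q1, Q2, Q3, Q4)
     projective Euler     (rho, phi, theta, psi), (P, Phi, Theta, Psi)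
     projective Andoyer   (rho, u1, u2, u3)     , (P, U1, U2, U3)
     Delaunay             (l, u1, g, u3)        , (L, U1, G, U3).
   Angles are real numbers, i.e. lifts of the classes modulo 2 pi. *)
Notation phase R := ('rV[R]_4 * 'rV[R]_4)%type.

Definition pos (R : realType) (z : phase R) (i : 'I_4) : R := z.1 0 i.
Definition mom (R : realType) (z : phase R) (i : 'I_4) : R := z.2 0 i.

Definition row4 (R : realType) (a b c d : R) : 'rV[R]_4 :=
  \row_(i < 4) [:: a; b; c; d]`_i.

(* dQ /\ dq *)
Definition sympl_form (R : realType) (v w : phase R) : R :=
  \sum_(i < 4) (mom v i * pos w i - mom w i * pos v i).

Definition symplectic_on (R : realType) (D : set (phase R))
    (F : phase R -> phase R) : Prop :=
  forall x, D x ->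
    differentiable F x /\
    forall v w, sympl_form ('d F x v) ('d F x w) = sympl_form v w.

(* Each of the three changes of variables is specified by formulas expressing
   old variables through new ones, partly implicitly; [rel new old] says that
   these formulas hold.  A symplectic transformation realizing [rel] on an open
   set D of new variables is a map from the new to the old variables. *)
Definition symplectic_transformation (R : realType)
    (rel : phase R -> phase R -> Prop) (D : set (phase R))
    (F : phase R -> phase R) : Prop :=
  [/\ open D, forall x, D x -> rel x (F x) & symplectic_on D F].

(** Projective Euler variables *)

Definition euler_point (R : realType) (x : 'rV[R]_4) : 'rV[R]_4 :=
  let rho := x 0 0 in let phi := x 0 1 in
  let theta := x 0 2 in let psi := x 0 3 in
  row4 (Num.sqrt rho * sin (theta / 2) * cos ((phi - psi) / 2))
       (Num.sqrt rho * sin (theta / 2) * sin ((phi - psi) / 2))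
       (Num.sqrt rho * cos (theta / 2) * sin ((phi + psi) / 2))
       (Num.sqrt rho * cos (theta / 2) * cos ((phi + psi) / 2)).

(* The last clause is the equality of one-forms
   sum_i Q_i dq_i = P drho + Phi dphi + Theta dtheta + Psi dpsi. *)
Definition projective_euler (R : realType) (x c : phase R) : Prop :=
  let rho := pos x 0 in let phi := pos x 1 in
  let theta := pos x 2 in let psi := pos x 3 in
  [/\ [/\ 0 < rho, 0 <= phi < 2 * pi, 0 < theta < pi
        & - (pi / 2) < psi < pi / 2],
      c.1 = euler_point x.1
    & forall v : 'rV[R]_4,
        \sum_(i < 4) mom c i * ('d (@euler_point R) (x.1) v) 0 i =
        \sum_(i < 4) mom x i * v 0 i].

Definition euler_domain (R : realType) : set (phase R) :=
  [set x | [/\ 0 < pos x 0, 0 < pos x 1 < 2 * pi, 0 < pos x 2 < pi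
             & - (pi / 2) < pos x 3 < pi / 2]].

(** Projective Andoyer variables *)

Definition projective_andoyer (R : realType) (y x : phase R) : Prop :=
  let rho := pos x 0 in let phi := pos x 1 in
  let theta := pos x 2 in let psi := pos x 3 in
  let P := mom x 0 in let Phi := mom x 1 in
  let Theta := mom x 2 in let Psi := mom x 3 in
  let u1 := pos y 1 in let u2 := pos y 2 in let u3 := pos y 3 in
  let U1 := mom y 1 in let U2 := mom y 2 in let U3 := mom y 3 in
  let c1 := U1 / U2 in let c2 := U3 / U2 in
  let s1 := Num.sqrt (1 - c1 ^+ 2) in let s2 := Num.sqrt (1 - c2 ^+ 2) in
  [/\ [/\ 0 < rho, 0 < theta < pi, `|U1| < U2 & `|U3| < U2],
      rho = pos y 0 /\ P = mom y 0,
      [/\ cos theta = c1 * c2 + s1 * s2 * cos u2,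
          sin (psi - u1) = sin u2 / sin theta * s2
        & sin (phi - u3) = sin u2 / sin theta * s1]
    & [/\ Phi = U3, Psi = U1
        & Theta = U2 * Num.sqrt (1 - (c1 ^+ 2 + c2 ^+ 2
                                      - 2 * c1 * c2 * cos theta)
                                     / sin theta ^+ 2)]].

(* The formulas force Theta = U2 s1 s2 |sin u2| / sin theta; this is compatible
   with dQ /\ dq only where sin u2 > 0. *)
Definition andoyer_domain (R : realType) : set (phase R) :=
  [set y | [/\ 0 < pos y 0, `|mom y 1| < mom y 2, `|mom y 3| < mom y 2
             & 0 < sin (pos y 2)]].

(** Delaunay variables *)

(* cos (E / 2) and cos (f / 2) are required to be nonzero so that the two
   tangents are genuine; 0 < G < L means 0 < e < 1. *)
Definition delaunay (R : realType) (gamma : R) (d y : phase R) : Prop :=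
  let l := pos d 0 in let g := pos d 2 in
  let L := mom d 0 in let G := mom d 2 in
  let rho := pos y 0 in let u2 := pos y 2 in
  let P := mom y 0 in let U2 := mom y 2 in
  let a := L ^+ 2 / gamma in
  let eta := G / L in
  let e := Num.sqrt (1 - eta ^+ 2) in
  [/\ 0 < G < L,
      [/\ pos y 1 = pos d 1, pos y 3 = pos d 3,
          mom y 1 = mom d 1 & mom y 3 = mom d 3]
    & exists f E : R,
      [/\ l = E - e * sin E,
          [/\ cos (E / 2) != 0, cos (f / 2) != 0
            & tan (f / 2) = Num.sqrt ((1 + e) / (1 - e)) * tan (E / 2)],
          u2 = g + f /\ U2 = G
        & rho = a * (1 - e * cos E) /\
          P = L * e * sin E / (a * (1 - e * cos E))]].

Definition delaunay_domain (R : realType) : set (phase R) :=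
  [set d | - pi < pos d 0 < pi /\ 0 < mom d 2 < mom d 0].

(** Hamiltonians *)

Definition isotropic_oscillator (R : realType) (omega : R) (c : phase R) : R :=
  1 / 2 * (\sum_(i < 4) mom c i ^+ 2)
  + 1 / 2 * omega ^+ 2 * (\sum_(i < 4) pos c i ^+ 2).

(* Poincare technique for the change of time ds = dtau / (4 rho), on the energy
   level h of the Hamiltonian H *)
Definition regularized (R : realType) (H rho : phase R -> R) (h : R)
    (z : phase R) : R := (H z - h) / (4 * rho z).

Definition kepler_delaunay (R : realType) (gamma : R) (d : phase R) : R :=
  - (gamma ^+ 2 / (2 * mom d 0 ^+ 2)).

(* Points at which the composition TE o TA o TD is defined *)
Definition comp_domain (R : realType) (DE DA DD : set (phase R))
    (TA TD : phase R -> phase R) : set (phase R) :=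
  [set d | [/\ DD d, DA (TD d) & DE (TA (TD d))]].

(* Main.v *)
(* In projective Euler variables the kinetic energy is
     2 rho P^2
     + (2 / rho) (Theta^2 + (Phi^2 + Psi^2 - 2 Phi Psi cos theta) / sin^2 theta),
   and the last bracket is U2^2 in Andoyer variables.  Hence (H2 - h) / (4 rho) is
   P^2 / 2 + U2^2 / (2 rho^2) - gamma / rho + omega^2 / 8, a planar Kepler
   Hamiltonian plus a constant, and Delaunay variables turn the Kepler part into
   - gamma^2 / (2 L^2).

   The three transformations exist globally on their domains.  The Euler one is
   the cotangent lift of polar coordinates, used three times.  The Andoyer one is
   generated by a function of (theta, U1, U2, U3), which makes the matrix of its
   partial derivatives symmetric.  For the Delaunay one, Kepler's equation is
   solved by the intermediate value theorem and differentiated implicitly. *)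

Require Import Defs.
From HB Require Import structures.
From mathcomp Require Import all_boot all_order all_algebra.
From mathcomp Require Import all_classical all_reals all_analysis.
From mathcomp Require Import ring lra.

Set Implicit Arguments.
Unset Strict Implicit.
Unset Printing Implicit Defensive.

Import Order.TTheory GRing.Theory Num.Theory.
Import numFieldNormedType.Exports.
Local Open Scope classical_set_scope.
Local Open Scope ring_scope.

(** * Differential calculus of scalar functions *)

(** Read from right to left, this inserts a factor equal to 1, after which a trigonometric identity
    closes by [ring] or [field] with sine and cosine as free atoms. *)
Lemma mul_cos2Dsin2 (R : realType) (a y : R) : (cos a ^+ 2 + sin a ^+ 2) * y = y.
Proof. by rewrite cos2Dsin2 mul1r. Qed.

Lemma is_diff_ext (R : realType) (V W : normedModType R) (f g df dg : V -> W)
    (x : V) : is_diff x f df -> f =1 g -> df =1 dg ->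
  is_diff x g dg.
Proof. by move=> fd /funext <- /funext <-. Qed.

Section ScalarCalculus.
Context {R : realType} {V : normedModType R}.
Implicit Types (f g df dg : V -> R) (x : V).

Lemma is_diff_fctD f g df dg x : is_diff x f df -> is_diff x g dg ->
  is_diff x (fun y => f y + g y) (fun v => df v + dg v).
Proof. by move=> ? ?; exact: is_diffD. Qed.

Lemma is_diff_fctN f df x : is_diff x f df ->
  is_diff x (fun y => - f y) (fun v => - df v).
Proof. by move=> ?; exact: is_diffN. Qed.

Lemma is_diff_fctM f g df dg x : is_diff x f df -> is_diff x g dg ->
  is_diff x (fun y => f y * g y) (fun v => f x * dg v + g x * df v).
Proof. by move=> ? ?; exact: is_diffM. Qed.

Lemma is_diff_fct_cst (a : R) x : is_diff x (fun=> a) (fun=> 0).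
Proof. exact: is_diff_cst. Qed.

Lemma is_diff_fct_comp (h : R -> R) (h' : R) f df x :
  is_diff x f df -> is_derive (f x) 1 h h' ->
  is_diff x (fun y => h (f y)) (fun v => h' * df v).
Proof.
move=> fd hd; have hf : differentiable h (f x).
  by apply/derivable1_diffP; exact: ex_derive.
apply: is_diff_eq (is_diff_comp _ (differentiableP hf)) _.
apply/funext => v /=; rewrite diff1E// derive1E derive_val.
by rewrite mulrC.
Qed.

Lemma is_diff_fctV f df x : is_diff x f df -> f x != 0 ->
  is_diff x (fun y => (f y)^-1) (fun v => - (f x ^- 2) * df v).
Proof.
move=> fd fx0; apply: DiffDef; first exact: differentiableV.
by rewrite diffV//; apply/funext => v /=; rewrite diff_val.
Qed.

Lemma is_diff_sqrt f df x : is_diff x f df -> 0 < f x ->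
  is_diff x (fun y => Num.sqrt (f y)) (fun v => (2 * Num.sqrt (f x))^-1 * df v).
Proof.
by move=> fd f0; apply: is_diff_fct_comp fd _; exact: is_derive1_sqrt.
Qed.

Lemma is_diff_sin f df x : is_diff x f df ->
  is_diff x (fun y => sin (f y)) (fun v => cos (f x) * df v).
Proof. by move=> fd; exact: is_diff_fct_comp. Qed.

Lemma is_diff_cos f df x : is_diff x f df ->
  is_diff x (fun y => cos (f y)) (fun v => - sin (f x) * df v).
Proof. by move=> fd; exact: is_diff_fct_comp. Qed.

(** The derivative keeps [sin (acos _)] instead of a square root, because the Andoyer angles come
    with explicitly known sines. *)
Lemma is_diff_acos f df x : is_diff x f df -> -1 < f x < 1 ->
  is_diff x (fun y => acos (f y)) (fun v => - (sin (acos (f x)))^-1 * df v).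
Proof.
move=> fd f1; apply: is_diff_fct_comp fd _; rewrite sin_acos.
  exact: is_derive1_acos.
by case/andP: f1 => /ltW -> /ltW ->.
Qed.

Lemma is_diff0 f x : f x = 0 ->
  (forall e, 0 < e -> \forall h \near 0, `|f (h + x)| <= e * `|h|) ->
  is_diff x f (fun=> 0).
Proof.
move=> fx0 fo.
have e1 : f \o shift x = cst (f x) + (0 : V -> R) +o_ 0 id.
  apply/eqaddoP => _/posnumP[e]; near=> h => /=.
  by rewrite !fctE /= fx0 addr0 subr0; near: h; exact: fo.
have zc : continuous (0 : V -> R) by exact: cst_continuous.
have d0 : 'd f x = 0 :> (V -> R) by exact: diff_unique.
by apply: DiffDef => //; apply/diff_locallyP; rewrite d0.
Unshelve. all: by end_near. Qed.

(* Carathéodory's form of differentiability: the factor [c] need only be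
   continuous at [x] because it multiplies an increment of [g]. *)
Lemma is_diff_increment (c g dg : V -> R) x : {for x, continuous c} ->
  is_diff x g dg ->
  is_diff x (fun y => c y * (g y - g x)) (fun v => c x * dg v).
Proof.
move=> cc gd; have gx : differentiable g x by [].
have [k k0 klip] : exists2 k, k > 0 & forall v, `|'d g x v| <= k * `|v|.
  exact/linear_lipschitz/diff_continuous.
(* Splitting [c y] as [c x + (c y - c x)] leaves a product of two increments: the first tends to 0
   and the second is at most linear, so the product is negligible. *)
suff d0 : is_diff x (fun y => (c y - c x) * (g y - g x)) (fun=> 0).
  have gB : is_diff x (fun y => g y - g x) (fun v => dg v).
    apply: (is_diff_ext (is_diff_fctD gd (is_diff_fct_cst (- g x) x))) => // v.
    by rewrite addr0.
  apply: (is_diff_ext (is_diff_fctD d0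
    (is_diff_fctM (is_diff_fct_cst (c x) x) gB))) => v /=; ring.
apply: is_diff0 => [|e e0]; first by rewrite subrr mul0r.
have k1 : 0 < k + 1 by rewrite ltr_wpDl// ltW.
have cn : \forall h \near (0 : V), `|c (h + x) - c x| <= e / (k + 1).
  have : \forall y \near x, `|c x - c y| <= e / (k + 1).
    by move/cvgrPdist_le: cc; apply; rewrite divr_gt0.
  rewrite (near_shift 0) subr0; apply: filterS => h /=.
  by rewrite distrC.
(* The constant [k + 1] is the Lipschitz constant [k] of the differential plus the remainder of the
   first-order expansion, taken with error ratio 1. *)
have gn : \forall h \near (0 : V), `|g (h + x) - g x| <= (k + 1) * `|h|.
  have /diff_locally/eqaddoP/(_ 1 ltr01) := gx.
  apply: filterS => h; rewrite !fctE /= mul1r => hh.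
  rewrite mulrDl mul1r -(subrK ('d g x h) (g (h + x) - g x)) addrC.
  by rewrite (le_trans (ler_normD _ _))// lerD// -addrA -opprD.
near=> h; rewrite normrM.
apply: (@le_trans _ _ (e / (k + 1) * ((k + 1) * `|h|))).
  by apply: ler_pM => //; near: h.
by rewrite mulrA divfK// gt_eqF.
Unshelve. all: by end_near. Qed.

End ScalarCalculus.

(** * Phase space in components *)

Lemma is_diff_linear (R : realType) (V W : normedModType R) (f : V -> W) (x : V) :
  linear f -> continuous f -> is_diff x f f.
Proof.
move=> lf cf.
pose fM := GRing.isLinear.Build _ _ _ _ _ lf.
pose fL : {linear _ -> _} := HB.pack f fM.
apply: DiffDef; first exact: (@linear_differentiable _ _ _ fL).
exact: (@diff_lin _ _ _ fL).
Qed.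

Lemma sum4E (R : nmodType) (F : 'I_4 -> R) :
  \sum_(i < 4) F i = F 0 + F 1 + F 2 + F 3.
Proof.
rewrite !big_ord_recl big_ord0 addr0 !addrA.
by congr (F _ + F _ + F _ + F _); exact/val_inj.
Qed.

Section Row4.
Context {R : realType}.

Lemma row4E (a b c d : R) :
  ((row4 a b c d 0 0 = a) * (row4 a b c d 0 1 = b)
   * (row4 a b c d 0 2 = c) * (row4 a b c d 0 3 = d))%type.
Proof. by do !split; rewrite mxE. Qed.

Lemma is_diff_row4 (V : normedModType R) (f0 f1 f2 f3 d0 d1 d2 d3 : V -> R)
    (x : V) :
  is_diff x f0 d0 -> is_diff x f1 d1 -> is_diff x f2 d2 -> is_diff x f3 d3 ->
  is_diff x (fun y => row4 (f0 y) (f1 y) (f2 y) (f3 y))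
            (fun v => row4 (d0 v) (d1 v) (d2 v) (d3 v)).
Proof.
move=> h0 h1 h2 h3.
have E (a b c d : R) : row4 a b c d = a *: delta_mx 0 0 + b *: delta_mx 0 1
    + c *: delta_mx 0 2 + d *: delta_mx 0 3.
  by apply/rowP => -[[|[|[|[|//]]]] lti]; rewrite !mxE /= !(mulr0, mulr1) ?addr0 ?add0r.
have Z (f df : V -> R) (w : 'rV[R]_4) : is_diff x f df ->
    is_diff x (fun y => f y *: w) (fun v => df v *: w).
  move=> fd; apply: DiffDef; first exact: differentiableZl.
  by rewrite diffZl// diff_val.
have D := is_diffD (is_diffD (is_diffD (Z _ _ (delta_mx 0 0) h0)
  (Z _ _ (delta_mx 0 1) h1)) (Z _ _ (delta_mx 0 2) h2)) (Z _ _ (delta_mx 0 3) h3).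
by apply: (is_diff_ext D) => v; rewrite E.
Qed.

End Row4.

Section Phase.
Context {R : realType}.

Lemma is_diff_pos (z : phase R) i :
  is_diff z (fun y => pos y i) (fun v => pos v i).
Proof.
apply: is_diff_linear => [a u v|y]; first by rewrite /pos !mxE.
apply: (@continuous_comp _ _ _ fst (fun N : 'rV[R]_4 => N 0 i)).
  exact: cvg_fst.
exact: coord_continuous.
Qed.

Lemma is_diff_mom (z : phase R) i :
  is_diff z (fun y => mom y i) (fun v => mom v i).
Proof.
apply: is_diff_linear => [a u v|y]; first by rewrite /mom !mxE.
apply: (@continuous_comp _ _ _ snd (fun N : 'rV[R]_4 => N 0 i)).
  exact: cvg_snd.
exact: coord_continuous.
Qed.

Lemma is_diff_coord (x : 'rV[R]_4) (i : 'I_4) :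
  is_diff x (fun y : 'rV[R]_4 => y 0 i) (fun v => v 0 i).
Proof.
apply: is_diff_linear => [a u v|y]; first by rewrite !mxE.
exact: coord_continuous.
Qed.

Lemma pos_continuous i : continuous (fun z : phase R => pos z i).
Proof. by move=> z; apply: differentiable_continuous; have [] := is_diff_pos z i. Qed.

Lemma mom_continuous i : continuous (fun z : phase R => mom z i).
Proof. by move=> z; apply: differentiable_continuous; have [] := is_diff_mom z i. Qed.

(** Exterior product of two one-forms at a fixed point. The one-forms are bare functions, so
    identities between two-forms become ring identities. *)
Definition wedge (V : Type) (a b : V -> R) (v w : V) : R := a v * b w - a w * b v.

Lemma sympl_formE (v w : phase R) : sympl_form v w =
  wedge (fun v => mom v 0) (fun v => pos v 0) v w
  + wedge (fun v => mom v 1) (fun v => pos v 1) v w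
  + wedge (fun v => mom v 2) (fun v => pos v 2) v w
  + wedge (fun v => mom v 3) (fun v => pos v 3) v w.
Proof. by rewrite /sympl_form sum4E. Qed.

(** Reduces symplecticity of a map with eight scalar components to one identity on the pulled-back
    two-form; the three changes of variables are all treated through it. *)
Lemma symplectic_row4 (x : phase R)
    (q0 q1 q2 q3 p0 p1 p2 p3 a0 a1 a2 a3 b0 b1 b2 b3 : phase R -> R) :
  is_diff x q0 a0 -> is_diff x q1 a1 -> is_diff x q2 a2 -> is_diff x q3 a3 ->
  is_diff x p0 b0 -> is_diff x p1 b1 -> is_diff x p2 b2 -> is_diff x p3 b3 ->
  (forall v w, wedge b0 a0 v w + wedge b1 a1 v w + wedge b2 a2 v w
               + wedge b3 a3 v w = sympl_form v w) ->
  let F z := (row4 (q0 z) (q1 z) (q2 z) (q3 z),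
              row4 (p0 z) (p1 z) (p2 z) (p3 z)) in
  differentiable F x /\
  forall v w, sympl_form ('d F x v) ('d F x w) = sympl_form v w.
Proof.
move=> ha0 ha1 ha2 ha3 hb0 hb1 hb2 hb3 H F.
have D := is_diff_pair (is_diff_row4 ha0 ha1 ha2 ha3)
  (is_diff_row4 hb0 hb1 hb2 hb3).
have -> : 'd F x = _ :> (_ -> _) := @diff_val _ _ _ _ _ _ _ D.
split; first exact: ex_diff.
move=> v w; rewrite sympl_formE -H /wedge /pos /mom /=.
by rewrite !row4E.
Qed.

Lemma open_lt_fun (T : topologicalType) (f g : T -> R) :
  continuous f -> continuous g -> open [set x | f x < g x].
Proof.
move=> cf cg.
rewrite (_ : [set _ | _] = (fun x => g x - f x) @^-1` [set y | 0 < y]).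
  apply: open_comp; last exact: open_gt.
  by move=> x _; apply: cvgB; [exact: cg|exact: cf].
by apply/seteqP; split => x /=; rewrite subr_gt0.
Qed.

End Phase.

(** * Polar coordinates and their cotangent lift *)

Section Polar.
Context {R : realType} {V : normedModType R}.
Implicit Types (r chi pr pchi : V -> R) (x : V).

Lemma is_diff_polar_cos r chi dr dchi x : is_diff x r dr -> is_diff x chi dchi ->
  is_diff x (fun y => r y * cos (chi y))
    (fun v => cos (chi x) * dr v - r x * sin (chi x) * dchi v).
Proof.
move=> hr hc; apply: (is_diff_ext (is_diff_fctM hr (is_diff_cos hc))) => // v.
ring.
Qed.

Lemma is_diff_polar_sin r chi dr dchi x : is_diff x r dr -> is_diff x chi dchi ->
  is_diff x (fun y => r y * sin (chi y))
    (fun v => sin (chi x) * dr v + r x * cos (chi x) * dchi v).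
Proof.
move=> hr hc; apply: (is_diff_ext (is_diff_fctM hr (is_diff_sin hc))) => // v.
ring.
Qed.

(** The cotangent lift of polar coordinates preserves the two-form. Radius, angle and momenta are
    arbitrary functions, so the lemma can be iterated; the differentials [a] and [b] stay abstract
    because only their wedge products matter later. *)
Lemma polar_symplectic r chi pr pchi dr dchi dpr dpchi x :
  is_diff x r dr -> is_diff x chi dchi ->
  is_diff x pr dpr -> is_diff x pchi dpchi -> r x != 0 ->
  exists a b : V -> R,
  [/\ is_diff x (fun y => pr y * cos (chi y) - pchi y / r y * sin (chi y)) a,
      is_diff x (fun y => pr y * sin (chi y) + pchi y / r y * cos (chi y)) b
    & forall v w,
        wedge a (fun v => cos (chi x) * dr v - r x * sin (chi x) * dchi v) v w
        + wedge b (fun v => sin (chi x) * dr v + r x * cos (chi x) * dchi v) v w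
        = wedge dpr dr v w + wedge dpchi dchi v w].
Proof.
move=> hr hc hp hpc r0.
have hq := is_diff_fctM hpc (is_diff_fctV hr r0).
have ha := is_diff_fctD (is_diff_polar_cos hp hc)
  (is_diff_fctN (is_diff_polar_sin hq hc)).
have hb := is_diff_fctD (is_diff_polar_sin hp hc) (is_diff_polar_cos hq hc).
eexists; eexists; split; [exact: ha|exact: hb|].
move=> v w; rewrite /wedge.
rewrite -[RHS](mul_cos2Dsin2 (chi x)).
move: (cos _) (sin _) (r x) r0 (pr x) (pchi x) => c s r' r0 p' pc'.
by field.
Qed.

End Polar.

(** * Projective Euler variables *)

Section Euler.
Context {R : realType}.

Definition euler_diff (x v : 'rV[R]_4) : 'rV[R]_4 :=
  let r := Num.sqrt (x 0 0) in
  let c := cos (x 0 2 / 2) in let s := sin (x 0 2 / 2) in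
  let c1 := cos ((x 0 1 - x 0 3) / 2) in let s1 := sin ((x 0 1 - x 0 3) / 2) in
  let c2 := cos ((x 0 1 + x 0 3) / 2) in let s2 := sin ((x 0 1 + x 0 3) / 2) in
  let dr := (2 * r)^-1 * v 0 0 in let dh := v 0 2 / 2 in
  let d1 := s * dr + r * c * dh in let d2 := c * dr - r * s * dh in
  let dx1 := (v 0 1 - v 0 3) / 2 in let dx2 := (v 0 1 + v 0 3) / 2 in
  row4 (c1 * d1 - r * s * s1 * dx1) (s1 * d1 + r * s * c1 * dx1)
       (s2 * d2 + r * c * c2 * dx2) (c2 * d2 - r * c * s2 * dx2).

(* (q1, q2) and (q4, q3) are polar with radii r sin (theta / 2) and
   r cos (theta / 2), which are themselves polar with radius r = sqrt rho. *)
Lemma is_diff_euler_point (x : 'rV[R]_4) : 0 < x 0 0 ->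
  is_diff x (@euler_point R) (euler_diff x).
Proof.
move=> x0.
have hc := is_diff_coord x.
have hr := is_diff_sqrt (hc 0) x0.
have hh := is_diff_fctM (hc 2) (is_diff_fct_cst 2^-1 x).
have h1 := is_diff_polar_sin hr hh.
have h2 := is_diff_polar_cos hr hh.
have hx1 := is_diff_fctM (is_diff_fctD (hc 1) (is_diff_fctN (hc 3)))
  (is_diff_fct_cst 2^-1 x).
have hx2 := is_diff_fctM (is_diff_fctD (hc 1) (hc 3)) (is_diff_fct_cst 2^-1 x).
apply: (is_diff_ext (is_diff_row4 (is_diff_polar_cos h1 hx1)
  (is_diff_polar_sin h1 hx1) (is_diff_polar_sin h2 hx2)
  (is_diff_polar_cos h2 hx2))) => // v.
by rewrite /euler_diff; congr row4; ring.
Qed.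

(** Comparison of the coefficients of the four coordinate differentials. [A] and [B] are the radial
    components of the momentum in the planes [(q1, q2)] and [(q4, q3)], [C] and [D] the tangential
    ones. One direction checks the explicit lift, the other computes the kinetic energy. *)
Lemma euler_oneformE (x Q p : 'rV[R]_4) : 0 < x 0 0 ->
  let r := Num.sqrt (x 0 0) in
  let c := cos (x 0 2 / 2) in let s := sin (x 0 2 / 2) in
  let c1 := cos ((x 0 1 - x 0 3) / 2) in let s1 := sin ((x 0 1 - x 0 3) / 2) in
  let c2 := cos ((x 0 1 + x 0 3) / 2) in let s2 := sin ((x 0 1 + x 0 3) / 2) in
  let A := Q 0 0 * c1 + Q 0 1 * s1 in let B := Q 0 2 * s2 + Q 0 3 * c2 in
  let C := Q 0 1 * c1 - Q 0 0 * s1 in let D := Q 0 2 * c2 - Q 0 3 * s2 in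
  (forall v, \sum_(i < 4) Q 0 i * ('d (@euler_point R) x v) 0 i
             = \sum_(i < 4) p 0 i * v 0 i) <->
  [/\ s * A + c * B = 2 * r * p 0 0, r * (c * A - s * B) = 2 * p 0 2,
      r * s * C = p 0 1 - p 0 3 & r * c * D = p 0 1 + p 0 3].
Proof.
move=> x0 r c s c1 s1 c2 s2 A B C D.
have -> : 'd (@euler_point R) x = euler_diff x :> (_ -> _).
  by have [] := is_diff_euler_point x0.
have r0 : r != 0 by rewrite gt_eqF// sqrtr_gt0.
have key v : \sum_(i < 4) Q 0 i * euler_diff x v 0 i - \sum_(i < 4) p 0 i * v 0 i
   = (s * A + c * B - 2 * r * p 0 0) * (v 0 0 / (2 * r))
     + (r * (c * A - s * B) - 2 * p 0 2) * (v 0 2 / 2)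
     + (r * s * C + r * c * D - 2 * p 0 1) * (v 0 1 / 2)
     + (r * c * D - r * s * C - 2 * p 0 3) * (v 0 3 / 2).
  rewrite !sum4E /euler_diff !row4E /A /B /C /D -/r -/c -/s -/c1 -/s1 -/c2 -/s2.
  by field.
split=> [H|[H0 H2 H1 H3] v]; last first.
  apply/eqP; rewrite -subr_eq0 key H0 H2 H1 H3; apply/eqP; ring.
have n2 : 2 != 0 :> R by rewrite pnatr_eq0.
have r20 : 2 * r != 0 by rewrite mulf_neq0.
(* Each test vector is scaled so that [key] returns one coefficient exactly. *)
have := key (row4 0 0 0 2); have := key (row4 0 2 0 0).
have := key (row4 0 0 2 0); have := key (row4 (2 * r) 0 0 0).
rewrite !H !subrr !row4E !mul0r !mulr0 !divff// !mulr1 !addr0 !add0r.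
move=> K0 K2 K1 K3.
by split; lra.
Qed.

(** Here [pr] is conjugate to [sqrt rho], [ph] to [theta / 2], and [m1], [m2] to [(phi - psi) / 2]
    and [(phi + psi) / 2]; [p1] and [p2] are the momenta conjugate to the intermediate radii [r1]
    and [r2]. *)
Definition euler_lift (x : phase R) : phase R :=
  let r := Num.sqrt (pos x 0) in let h := pos x 2 * 2^-1 in
  let chi1 := (pos x 1 - pos x 3) * 2^-1 in
  let chi2 := (pos x 1 + pos x 3) * 2^-1 in
  let pr := (2 * r) * mom x 0 in let ph := 2 * mom x 2 in
  let r1 := r * sin h in let r2 := r * cos h in
  let p1 := pr * sin h + ph / r * cos h in
  let p2 := pr * cos h - ph / r * sin h in
  let m1 := mom x 1 - mom x 3 in let m2 := mom x 1 + mom x 3 in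
  (row4 (r1 * cos chi1) (r1 * sin chi1) (r2 * sin chi2) (r2 * cos chi2),
   row4 (p1 * cos chi1 - m1 / r1 * sin chi1)
        (p1 * sin chi1 + m1 / r1 * cos chi1)
        (p2 * sin chi2 + m2 / r2 * cos chi2)
        (p2 * cos chi2 - m2 / r2 * sin chi2)).

Lemma half_angle_gt0 (theta : R) : 0 < theta < pi ->
  0 < sin (theta / 2) /\ 0 < cos (theta / 2).
Proof.
move=> /andP[t0 tpi]; split.
  by apply: sin_gt0_pihalf; rewrite divr_gt0//= ltr_pM2r.
apply: cos_gt0_pihalf; rewrite ltr_pM2r// tpi andbT.
by rewrite (@lt_trans _ _ 0)// ?divr_gt0// oppr_lt0 divr_gt0// pi_gt0.
Qed.

Lemma euler_lift_rel (x : phase R) : euler_domain x ->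
  projective_euler x (euler_lift x).
Proof.
move=> [rho0 /andP[phi0 phi1] theta0 psi0].
split; [by split=> //; rewrite ltW//= phi1|by []|].
have [s0 c0] := half_angle_gt0 theta0.
have r0 : 0 < Num.sqrt (pos x 0) by rewrite sqrtr_gt0.
apply/euler_oneformE => //; rewrite /euler_lift /= !row4E.
move: s0 c0 r0; rewrite /pos /mom.
have rotE (chi p m : R) :
    ((p * cos chi - m * sin chi) * cos chi
     + (p * sin chi + m * cos chi) * sin chi = p)
    * ((p * sin chi + m * cos chi) * cos chi
       - (p * cos chi - m * sin chi) * sin chi = m).
  by split; rewrite -[RHS](mul_cos2Dsin2 chi); ring.
have rotE' (chi p m : R) :
    (p * sin chi + m * cos chi) * sin chi + (p * cos chi - m * sin chi) * cos chi = p.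
  by rewrite addrC (rotE _ _ _).1.
rewrite !rotE !rotE' => s0 c0 r0.
split; [rewrite -[RHS](mul_cos2Dsin2 (x.1 0 2 / 2))
       |rewrite -[RHS](mul_cos2Dsin2 (x.1 0 2 / 2))| |];
  by field; rewrite ?gt_eqF.
Qed.

Lemma euler_lift_symplectic : symplectic_on (@euler_domain R) euler_lift.
Proof.
move=> x [rho0 _ theta0 _].
have [s0 c0] := half_angle_gt0 theta0.
have r0 : 0 < Num.sqrt (pos x 0) by rewrite sqrtr_gt0.
have hpos := is_diff_pos x; have hmom := is_diff_mom x.
have hr := is_diff_sqrt (hpos 0) rho0.
have hh := is_diff_fctM (hpos 2) (is_diff_fct_cst 2^-1 x).
have hpr := is_diff_fctM (is_diff_fctM (is_diff_fct_cst 2 x) hr) (hmom 0).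
have hph := is_diff_fctM (is_diff_fct_cst 2 x) (hmom 2).
have rn0 : Num.sqrt (pos x 0) != 0 by rewrite gt_eqF.
(* Inner polar lift: [(sqrt rho, theta / 2)] produces the two radii. Its output momenta serve below
   as radial momenta of the outer lifts in the two planes. *)
have [d2 [d1 [hp2 hp1 w12]]] := polar_symplectic hr hh hpr hph rn0.
have h1 := is_diff_polar_sin hr hh.
have h2 := is_diff_polar_cos hr hh.
have hx1 := is_diff_fctM (is_diff_fctD (hpos 1) (is_diff_fctN (hpos 3)))
  (is_diff_fct_cst 2^-1 x).
have hx2 := is_diff_fctM (is_diff_fctD (hpos 1) (hpos 3)) (is_diff_fct_cst 2^-1 x).
have hm1 := is_diff_fctD (hmom 1) (is_diff_fctN (hmom 3)).
have hm2 := is_diff_fctD (hmom 1) (hmom 3).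
have r1n0 : Num.sqrt (pos x 0) * sin (pos x 2 * 2^-1) != 0 by rewrite mulf_neq0// gt_eqF.
have r2n0 : Num.sqrt (pos x 0) * cos (pos x 2 * 2^-1) != 0 by rewrite mulf_neq0// gt_eqF.
have [e1 [e1' [hQ1 hQ2 wA]]] := polar_symplectic h1 hx1 hp1 hm1 r1n0.
have [e2 [e2' [hQ4 hQ3 wB]]] := polar_symplectic h2 hx2 hp2 hm2 r2n0.
apply: (symplectic_row4 (is_diff_polar_cos h1 hx1)
  (is_diff_polar_sin h1 hx1) (is_diff_polar_sin h2 hx2)
  (is_diff_polar_cos h2 hx2) hQ1 hQ2 hQ3 hQ4) => v w.
(* The second plane lists its sine component first, hence the swap before [wB]. The radial terms of
   both planes are then gathered to apply [w12]. *)
rewrite wA -addrA [X in _ + X = _]addrC wB sympl_formE.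
rewrite addrACA [X in X + _ = _]addrC w12 /wedge.
by field; rewrite gt_eqF.
Qed.

End Euler.

(** * Projective Andoyer variables *)

Section AndoyerAlgebra.
Context {F : fieldType}.
Variables c1 c2 s1 s2 cu su X S : F.
Hypotheses (s1_neq0 : s1 != 0) (s2_neq0 : s2 != 0) (su_neq0 : su != 0)
  (S_neq0 : S != 0).
Hypotheses (s1E : s1 ^+ 2 = 1 - c1 ^+ 2) (s2E : s2 ^+ 2 = 1 - c2 ^+ 2)
  (suE : su ^+ 2 = 1 - cu ^+ 2) (SE : S ^+ 2 = 1 - X ^+ 2)
  (XE : X = c1 * c2 + s1 * s2 * cu).

Let D := s1 * s2 * su.
Let t1 := (c1 - c2 * X) / (S * D).
Let t2 := (c2 - c1 * X) / (S * D).
Let g := D / S.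

Variables dc1 dc2 ds1 ds2 du dtheta : F.
Hypotheses (ds1E : ds1 = - (c1 / s1) * dc1) (ds2E : ds2 = - (c2 / s2) * dc2).

(** The hypothesis is the differentiated spherical law of cosines [XE]; it is solved for [du] by
    dividing by [D], after eliminating [ds1] and [ds2]. *)
Lemma andoyer_du :
  - S * dtheta = dc1 * c2 + c1 * dc2 + (ds1 * s2 + s1 * ds2) * cu
                 - s1 * s2 * su * du ->
  du = S / D * dtheta + (c2 / D - c1 * cu / (s1 ^+ 2 * su)) * dc1
                      + (c1 / D - c2 * cu / (s2 ^+ 2 * su)) * dc2.
Proof.
move=> E.
have -> : du = (S * dtheta + (dc1 * c2 + c1 * dc2 + (ds1 * s2 + s1 * ds2) * cu)) / D.
  have -> : S * dtheta = - (- S * dtheta) by ring.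
  by rewrite E /D; field; rewrite s1_neq0 s2_neq0 su_neq0.
by rewrite ds1E ds2E /D; field; rewrite s1_neq0 s2_neq0 su_neq0.
Qed.

Hypothesis duE :
  du = S / D * dtheta + (c2 / D - c1 * cu / (s1 ^+ 2 * su)) * dc1
                      + (c1 / D - c2 * cu / (s2 ^+ 2 * su)) * dc2.

(** The left side is the derivative of the arc cosine defining [alpha], with its sine replaced by
    [s2 * su / S]. The coefficient [D^-1] of [dc2] reappears as that of [dc1] in [andoyer_dbeta]:
    this is the symmetry of mixed second derivatives. *)
Lemma andoyer_dalpha :
  - (S / (s2 * su)) * (((dc1 * s2 + c1 * ds2) * cu - c1 * s2 * su * du
       - (ds1 * c2 + s1 * dc2) - (c1 * s2 * cu - s1 * c2) / S * (X * dtheta)) / S)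
  = - (cu / (s1 ^+ 2 * su)) * dc1 + D^-1 * dc2 + t1 * dtheta.
Proof.
rewrite duE ds1E ds2E /t1 /D.
field: s1E s2E suE SE XE; by rewrite ?s1_neq0 ?s2_neq0 ?su_neq0 ?S_neq0.
Qed.

Lemma andoyer_dbeta :
  - (S / (s1 * su)) * (((dc2 * s1 + c2 * ds1) * cu - c2 * s1 * su * du
       - (ds2 * c1 + s2 * dc1) - (c2 * s1 * cu - s2 * c1) / S * (X * dtheta)) / S)
  = D^-1 * dc1 + - (cu / (s2 ^+ 2 * su)) * dc2 + t2 * dtheta.
Proof.
rewrite duE ds1E ds2E /t2 /D.
field: s1E s2E suE SE XE; by rewrite ?s1_neq0 ?s2_neq0 ?su_neq0 ?S_neq0.
Qed.

Lemma andoyer_dg :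
  ((ds1 * s2 + s1 * ds2) * su + s1 * s2 * cu * du - g * (X * dtheta)) / S
  = - t1 * dc1 - t2 * dc2
    + (X * (c1 ^+ 2 + c2 ^+ 2 - 2 * c1 * c2 * X) - c1 * c2 * S ^+ 2)
      / (S ^+ 2 * D) * dtheta.
Proof.
rewrite duE ds1E ds2E /t1 /t2 /g /D.
field: s1E s2E suE SE XE; by rewrite ?s1_neq0 ?s2_neq0 ?su_neq0 ?S_neq0.
Qed.

(** Equality of two mixed derivatives at fixed momenta or angle: with [Theta = U2 * g], the left
    side is the derivative of [Theta] in [U2], and the right side that of [u2] in [theta]. *)
Lemma andoyer_sum : c1 * t1 + c2 * t2 + g = S / D.
Proof.
rewrite /t1 /t2 /g /D.
field: s1E s2E suE SE XE; by rewrite ?s1_neq0 ?s2_neq0 ?su_neq0 ?S_neq0.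
Qed.

End AndoyerAlgebra.

(* With [dU1 = U2 dc1 + c1 dU2] and [dU3 = U2 dc2 + c2 dU2], the coefficients of
   the differentials of [u2], [alpha], [beta] and [g] in the coframe
   [dtheta, dc1, dc2, dU2] are the second derivatives of a generating function;
   only their symmetry matters here. *)
Lemma andoyer_wedge (F : comRingType) (V : Type) (U c1 c2 g k a1 a2 b t1 t2 n : F)
    (dU dc1 dc2 dtheta du dalpha dbeta dg : V -> F) (v w : V) :
  (forall x, du x = k * dtheta x + (c1 * a1 + c2 * b) * dc1 x
                    + (c1 * b + c2 * a2) * dc2 x) ->
  (forall x, dalpha x = a1 * dc1 x + b * dc2 x + t1 * dtheta x) ->
  (forall x, dbeta x = b * dc1 x + a2 * dc2 x + t2 * dtheta x) ->
  (forall x, dg x = - t1 * dc1 x - t2 * dc2 x + n * dtheta x) ->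
  c1 * t1 + c2 * t2 + g = k ->
  let dTheta x := U * dg x + g * dU x in
  let dU1 x := U * dc1 x + c1 * dU x in
  let dU3 x := U * dc2 x + c2 * dU x in
  (dU3 v * dbeta w - dU3 w * dbeta v) + (dTheta v * dtheta w - dTheta w * dtheta v)
  + (dU1 v * dalpha w - dU1 w * dalpha v) = dU v * du w - dU w * du v.
Proof.
by move=> duE daE dbE dgE kE /=; rewrite !duE !daE !dbE !dgE -kE; ring.
Qed.

(** * The explicit Andoyer transformation on its domain *)

Section Andoyer.
Context {R : realType}.

Definition andoyer_c1 (y : phase R) : R := mom y 1 / mom y 2.
Definition andoyer_c2 (y : phase R) : R := mom y 3 / mom y 2.
Definition andoyer_s1 (y : phase R) : R := Num.sqrt (1 - andoyer_c1 y ^+ 2).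
Definition andoyer_s2 (y : phase R) : R := Num.sqrt (1 - andoyer_c2 y ^+ 2).
Definition andoyer_theta (y : phase R) : R :=
  acos (andoyer_c1 y * andoyer_c2 y
        + andoyer_s1 y * andoyer_s2 y * cos (pos y 2)).
(** On [andoyer_domain], consider the spherical triangle whose sides have cosines [c1], [c2] and
    [cos theta], with angle [u2] modulo [2 * pi] opposite [theta]. This is the supplement of the
    angle opposite the second side; [andoyer_beta] exchanges the first two sides. *)
Definition andoyer_alpha (y : phase R) : R :=
  acos ((andoyer_c1 y * andoyer_s2 y * cos (pos y 2)
         - andoyer_s1 y * andoyer_c2 y) / sin (andoyer_theta y)).
Definition andoyer_beta (y : phase R) : R :=
  acos ((andoyer_c2 y * andoyer_s1 y * cos (pos y 2)
         - andoyer_s2 y * andoyer_c1 y) / sin (andoyer_theta y)).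

(* The relations only fix the sines of [psi - u1] and [phi - u3]; this is the
   branch for which the transformation is symplectic. *)
Definition andoyer_lift (y : phase R) : phase R :=
  (row4 (pos y 0) (pos y 3 + andoyer_beta y) (andoyer_theta y)
        (pos y 1 + andoyer_alpha y),
   row4 (mom y 0) (mom y 3)
     (mom y 2 * (andoyer_s1 y * andoyer_s2 y * sin (pos y 2)
                 / sin (andoyer_theta y)))
     (mom y 1)).

Lemma ratio_sqr_lt1 (a b : R) : `|a| < b -> (a / b) ^+ 2 < 1.
Proof.
move=> ab; have b0 : 0 < b by exact: le_lt_trans ab.
rewrite -real_normK ?num_real// expr_lt1//.
by rewrite normrM normfV (gtr0_norm b0) ltr_pdivrMr// mul1r.
Qed.

Lemma andoyer_s1P (y : phase R) : `|mom y 1| < mom y 2 ->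
  0 < andoyer_s1 y /\ andoyer_s1 y ^+ 2 = 1 - andoyer_c1 y ^+ 2.
Proof.
move=> /ratio_sqr_lt1 h; rewrite sqrtr_gt0 sqr_sqrtr ?subr_gt0//.
by rewrite subr_ge0 ltW.
Qed.

Lemma andoyer_s2P (y : phase R) : `|mom y 3| < mom y 2 ->
  0 < andoyer_s2 y /\ andoyer_s2 y ^+ 2 = 1 - andoyer_c2 y ^+ 2.
Proof.
move=> /ratio_sqr_lt1 h; rewrite sqrtr_gt0 sqr_sqrtr ?subr_gt0//.
by rewrite subr_ge0 ltW.
Qed.

Lemma sqr_lt1_itv (x : R) : x ^+ 2 < 1 -> -1 < x < 1.
Proof.
by rewrite -real_normK ?num_real// expr_lt1// ltr_norml.
Qed.

Lemma acosP (x z : R) : 0 < z -> x ^+ 2 + z ^+ 2 = 1 ->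
  [/\ -1 < x < 1, 0 < acos x < pi, cos (acos x) = x & sin (acos x) = z].
Proof.
move=> z0 xz; have x1 : -1 < x < 1.
  by apply: sqr_lt1_itv; rewrite -xz ltrDl exprn_gt0.
case/andP: (x1) => xl xr; split=> //.
- by rewrite acos_gt0 ?acos_ltpi// ?xl ?xr ?(ltW xl) ?(ltW xr).
- by rewrite acosK// in_itv/= !ltW.
rewrite sin_acos ?ltW//.
have -> : 1 - x ^+ 2 = z ^+ 2 by rewrite -xz; ring.
by rewrite sqrtr_sqr gtr0_norm.
Qed.

Lemma andoyer_angles (y : phase R) : andoyer_domain y ->
  let c1 := andoyer_c1 y in let c2 := andoyer_c2 y in
  let s1 := andoyer_s1 y in let s2 := andoyer_s2 y in
  let cu := cos (pos y 2) in let su := sin (pos y 2) in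
  let X := c1 * c2 + s1 * s2 * cu in let S := sin (andoyer_theta y) in
  [/\ [/\ -1 < X < 1, 0 < andoyer_theta y < pi, cos (andoyer_theta y) = X & 0 < S],
     -1 < (c1 * s2 * cu - s1 * c2) / S < 1 /\ sin (andoyer_alpha y) = su / S * s2
   & -1 < (c2 * s1 * cu - s2 * c1) / S < 1 /\ sin (andoyer_beta y) = su / S * s1].
Proof.
move=> [_ /andoyer_s1P[s10 s1E] /andoyer_s2P[s20 s2E] su0] c1 c2 s1 s2 cu su X S.
rewrite -/s1 -/s2 -/c1 -/c2 -/su in s10 s1E s20 s2E su0.
have suE : su ^+ 2 = 1 - cu ^+ 2 by exact: sin2cos2.
(* After division by [S ^+ 2] this is the Pythagorean identity for [alpha]. It also yields
   [X ^+ 2 < 1], because [su * s2] is positive. *)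
have hA : (c1 * s2 * cu - s1 * c2) ^+ 2 + (su * s2) ^+ 2 = 1 - X ^+ 2.
  by rewrite /X; ring: s1E s2E suE.
have hB : (c2 * s1 * cu - s2 * c1) ^+ 2 + (su * s1) ^+ 2 = 1 - X ^+ 2.
  by rewrite /X; ring: s1E s2E suE.
have X0 : 0 < 1 - X ^+ 2.
  by rewrite -hA ltr_wpDl ?sqr_ge0// exprn_gt0// mulr_gt0.
have [X1 tpi cosX sinX] : [/\ -1 < X < 1, 0 < andoyer_theta y < pi,
    cos (andoyer_theta y) = X & S = Num.sqrt (1 - X ^+ 2)].
  by apply: acosP; rewrite ?sqrtr_gt0// sqr_sqrtr ?ltW// addrC subrK.
have S0 : 0 < S by rewrite sinX sqrtr_gt0.
have S2 : S ^+ 2 = 1 - X ^+ 2 by rewrite sinX sqr_sqrtr// ltW.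
have [A1 _ _ sA] := @acosP ((c1 * s2 * cu - s1 * c2) / S) (su / S * s2)
  ltac:(by rewrite !mulr_gt0 ?invr_gt0)
  ltac:(by rewrite [su / S * _]mulrAC !expr_div_n -mulrDl hA -S2 divff//
                   expf_neq0// gt_eqF).
have [B1 _ _ sB] := @acosP ((c2 * s1 * cu - s2 * c1) / S) (su / S * s1)
  ltac:(by rewrite !mulr_gt0 ?invr_gt0)
  ltac:(by rewrite [su / S * _]mulrAC !expr_div_n -mulrDl hB -S2 divff//
                   expf_neq0// gt_eqF).
by [].
Qed.

Lemma andoyer_lift_rel (y : phase R) : andoyer_domain y ->
  projective_andoyer y (andoyer_lift y).
Proof.
move=> yD; have [[_ theta0 cosE S0] [_ sA] [_ sB]] := andoyer_angles yD.
case: yD => rho0 U1 U3 su0.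
have [s10 s1E] := andoyer_s1P U1; have [s20 s2E] := andoyer_s2P U3.
rewrite /projective_andoyer /andoyer_lift /pos /mom /= !row4E.
rewrite -/(pos y 0) -/(pos y 1) -/(pos y 2) -/(pos y 3).
rewrite -/(mom y 0) -/(mom y 1) -/(mom y 2) -/(mom y 3).
rewrite -/(andoyer_c1 y) -/(andoyer_c2 y) -/(andoyer_s1 y) -/(andoyer_s2 y).
split=> //; first by rewrite ![_ + _ - _]addrAC !subrr !add0r.
split=> //; congr (_ * _).
set S := sin _ in S0 *; set cu := cos (pos y 2) in cosE *.
set su := sin (pos y 2) in su0 *.
have SE : S ^+ 2 = 1 - cos (andoyer_theta y) ^+ 2 by exact: sin2cos2.
have suE : su ^+ 2 = 1 - cu ^+ 2 by exact: sin2cos2.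
(* The product is positive, so it is the square root of its own square, and the two radicands can be
   compared. *)
rewrite -[LHS]gtr0_norm; last by rewrite !(mulr_gt0, invr_gt0).
rewrite -sqrtr_sqr; congr Num.sqrt.
by field: s1E s2E suE SE cosE; rewrite gt_eqF.
Qed.

Lemma andoyer_lift_symplectic : symplectic_on (@andoyer_domain R) andoyer_lift.
Proof.
move=> y yD.
have [[X1 theta0 cosE S0] [A1 sA] [B1 sB]] := andoyer_angles yD.
case: (yD) => rho0 U1 U3 su0.
have U20 : 0 < mom y 2 by exact: le_lt_trans U1.
have U2n0 : mom y 2 != 0 by rewrite gt_eqF.
have [s10 s1E] := andoyer_s1P U1; have [s20 s2E] := andoyer_s2P U3.
have hpos := is_diff_pos y; have hmom := is_diff_mom y.
pose dc1 v := (mom v 1 - andoyer_c1 y * mom v 2) / mom y 2.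
pose dc2 v := (mom v 3 - andoyer_c2 y * mom v 2) / mom y 2.
have hc1 : is_diff y andoyer_c1 dc1.
  apply: (is_diff_ext (is_diff_fctM (hmom 1) (is_diff_fctV (hmom 2) U2n0))) => // v.
  by rewrite /dc1 /andoyer_c1; field.
have hc2 : is_diff y andoyer_c2 dc2.
  apply: (is_diff_ext (is_diff_fctM (hmom 3) (is_diff_fctV (hmom 2) U2n0))) => // v.
  by rewrite /dc2 /andoyer_c2; field.
pose ds1 v := - (andoyer_c1 y / andoyer_s1 y) * dc1 v.
pose ds2 v := - (andoyer_c2 y / andoyer_s2 y) * dc2 v.
have s1n0 : andoyer_s1 y != 0 by rewrite gt_eqF.
have s2n0 : andoyer_s2 y != 0 by rewrite gt_eqF.
have hs1 : is_diff y andoyer_s1 ds1.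
  have := is_diff_fctD (is_diff_fct_cst 1 y) (is_diff_fctN (is_diff_fctM hc1 hc1)).
  move=> /is_diff_sqrt H.
  apply: (is_diff_ext (H _)) => [|v|v].
  - by rewrite -expr2 -s1E exprn_gt0.
  - by rewrite -expr2.
  - by rewrite -expr2 -/(andoyer_s1 y) /ds1; field.
have hs2 : is_diff y andoyer_s2 ds2.
  have := is_diff_fctD (is_diff_fct_cst 1 y) (is_diff_fctN (is_diff_fctM hc2 hc2)).
  move=> /is_diff_sqrt H.
  apply: (is_diff_ext (H _)) => [|v|v].
  - by rewrite -expr2 -s2E exprn_gt0.
  - by rewrite -expr2.
  - by rewrite -expr2 -/(andoyer_s2 y) /ds2; field.
have hcu := is_diff_cos (hpos 2).
have hsu := is_diff_sin (hpos 2).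
pose dX v := dc1 v * andoyer_c2 y + andoyer_c1 y * dc2 v
  + (ds1 v * andoyer_s2 y + andoyer_s1 y * ds2 v) * cos (pos y 2)
  - andoyer_s1 y * andoyer_s2 y * sin (pos y 2) * pos v 2.
pose dth v := - (sin (andoyer_theta y))^-1 * dX v.
have hth : is_diff y andoyer_theta dth.
  have := is_diff_acos (is_diff_fctD (is_diff_fctM hc1 hc2)
    (is_diff_fctM (is_diff_fctM hs1 hs2) hcu)) X1.
  move=> H; apply: (is_diff_ext H) => // v; rewrite /dth /dX; congr (_ * _).
  by ring.
have Sn0 : sin (andoyer_theta y) != 0 by rewrite gt_eqF.
have sun0 : sin (pos y 2) != 0 by rewrite gt_eqF.
have dthE v : - sin (andoyer_theta y) * dth v = dX v by rewrite /dth; field.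
have duE v := andoyer_du s1n0 s2n0 sun0 (erefl (ds1 v)) (erefl (ds2 v)) (dthE v).
have hS := is_diff_sin hth.
have suE : sin (pos y 2) ^+ 2 = 1 - cos (pos y 2) ^+ 2 by exact: sin2cos2.
have SE : sin (andoyer_theta y) ^+ 2 = 1 - cos (andoyer_theta y) ^+ 2.
  exact: sin2cos2.
have halpha := is_diff_acos (is_diff_fctM (is_diff_fctD
  (is_diff_fctM (is_diff_fctM hc1 hs2) hcu) (is_diff_fctN (is_diff_fctM hs1 hc2)))
  (is_diff_fctV hS Sn0)) A1.
have hbeta := is_diff_acos (is_diff_fctM (is_diff_fctD
  (is_diff_fctM (is_diff_fctM hc2 hs1) hcu) (is_diff_fctN (is_diff_fctM hs2 hc1)))
  (is_diff_fctV hS Sn0)) B1.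
have hg := is_diff_fctM (is_diff_fctM (is_diff_fctM hs1 hs2) hsu)
  (is_diff_fctV hS Sn0).
pose c1 := andoyer_c1 y; pose c2 := andoyer_c2 y.
pose s1 := andoyer_s1 y; pose s2 := andoyer_s2 y.
pose cu := cos (pos y 2); pose su := sin (pos y 2).
pose S := sin (andoyer_theta y); pose X := cos (andoyer_theta y).
pose D := s1 * s2 * su; pose t1 := (c1 - c2 * X) / (S * D).
pose t2 := (c2 - c1 * X) / (S * D).
pose a1 := - (cu / (s1 ^+ 2 * su)); pose a2 := - (cu / (s2 ^+ 2 * su)).
pose da v := a1 * dc1 v + D^-1 * dc2 v + t1 * dth v.
pose db v := D^-1 * dc1 v + a2 * dc2 v + t2 * dth v.
pose n := (X * (c1 ^+ 2 + c2 ^+ 2 - 2 * c1 * c2 * X) - c1 * c2 * S ^+ 2)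
          / (S ^+ 2 * D).
pose dg v := - t1 * dc1 v - t2 * dc2 v + n * dth v.
(* The known sine of [alpha] brings the raw derivative of the arc cosine to the left side of
   [andoyer_dalpha]. *)
have {}halpha : is_diff y andoyer_alpha da.
  apply: (is_diff_ext halpha) => // v.
  rewrite -[RHS](andoyer_dalpha s1n0 s2n0 sun0 Sn0 s1E s2E suE SE cosE
    (erefl (ds1 v)) (erefl (ds2 v)) (duE v)).
  by rewrite -/(andoyer_alpha y) sA; field; rewrite s2n0 sun0 Sn0.
have {}hbeta : is_diff y andoyer_beta db.
  apply: (is_diff_ext hbeta) => // v.
  rewrite -[RHS](andoyer_dbeta s1n0 s2n0 sun0 Sn0 s1E s2E suE SE cosE
    (erefl (ds1 v)) (erefl (ds2 v)) (duE v)).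
  by rewrite -/(andoyer_beta y) sB; field; rewrite s1n0 sun0 Sn0.
have {}hg : is_diff y (fun z => andoyer_s1 z * andoyer_s2 z * sin (pos z 2)
    / sin (andoyer_theta z)) dg.
  apply: (is_diff_ext hg) => // v.
  rewrite -[RHS](andoyer_dg s1n0 s2n0 sun0 Sn0 s1E s2E suE SE cosE
    (erefl (ds1 v)) (erefl (ds2 v)) (duE v)).
  by field; rewrite Sn0.
apply: (symplectic_row4 (hpos 0) (is_diff_fctD (hpos 3) hbeta) hth
  (is_diff_fctD (hpos 1) halpha) (hmom 0) (hmom 3) (is_diff_fctM (hmom 2) hg)
  (hmom 1)) => v w.
(* Regroups the coefficients of [du2] as combinations of those of [dalpha] and [dbeta], the shape
   required by [andoyer_wedge]. *)
have {}duE z : pos z 2 = S / D * dth z + (c1 * a1 + c2 * D^-1) * dc1 z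
    + (c1 * D^-1 + c2 * a2) * dc2 z.
  rewrite duE -/D; congr (_ + _ * _ + _ * _);
    rewrite /a1 /a2 -/c1 -/c2 -/cu -/su -/s1 -/s2.
    by ring.
  by ring.
have W := andoyer_wedge (mom y 2) (fun v => mom v 2) v w duE
  (fun=> erefl (da _)) (fun=> erefl (db _)) (fun=> erefl (dg _))
  (andoyer_sum s1n0 s2n0 sun0 Sn0 s1E s2E suE SE cosE).
have dU1E z : mom z 1 = mom y 2 * dc1 z + c1 * mom z 2.
  by rewrite /dc1 /c1 /andoyer_c1; field.
have dU3E z : mom z 3 = mom y 2 * dc2 z + c2 * mom z 2.
  by rewrite /dc2 /c2 /andoyer_c2; field.
rewrite /= -!dU1E -!dU3E in W.
rewrite sympl_formE /wedge -W.
by clearbody da db dg dth; ring.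
Qed.

End Andoyer.

(** * Kepler's equation *)

Section Kepler.
Context {R : realType}.

(** The endpoints come in either order, and the intermediate point is located by its distance to
    [a], so that it tends to [a] with [b]. *)
Lemma sin_MVT (a b : R) :
  exists2 xi, `|xi - a| <= `|b - a| & sin b - sin a = cos xi * (b - a).
Proof.
have dsin (x y : R) z : z \in `]x, y[ -> is_derive z 1 (@sin R) (cos z).
  by move=> _; exact: is_derive_sin.
have csin (x y : R) : {within `[x, y], continuous (@sin R)}.
  by apply: continuous_subspaceT => z; exact: continuous_sin.
have [ab|ba] := leP a b.
  have [xi] := MVT_segment ab (dsin a b) (csin a b).
  rewrite in_itv/= => /andP[x1 x2] E; exists xi => //.
  by rewrite !ger0_norm ?subr_ge0// lerD2r.
have [xi] := MVT_segment (ltW ba) (dsin b a) (csin b a).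
rewrite in_itv/= => /andP[x1 x2] E; exists xi; last by rewrite -opprB E -mulrN opprB.
by rewrite (ler0_norm (_ : xi - a <= 0)) ?(ler0_norm (_ : b - a <= 0)); lra.
Qed.

Lemma sin_lipschitz (a b : R) : `|sin b - sin a| <= `|b - a|.
Proof.
have [xi _ ->] := sin_MVT a b.
by rewrite normrM ler_piMl// cos_max.
Qed.

(** [get] selects some root; its regularity is later derived from Kepler's equation alone. *)
Definition eccentric_anomaly (e l : R) : R := get [set E | l = E - e * sin E].

(** Since [e * sin x] lies between -1 and 1, the function [x - e * sin x] is at most [l] at [l - 1]
    and at least [l] at [l + 1]. *)
Lemma eccentric_anomalyP (e l : R) : 0 <= e <= 1 ->
  l = eccentric_anomaly e l - e * sin (eccentric_anomaly e l).
Proof.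
move=> /andP[e0 e1].
suff : exists E, l = E - e * sin E by exact: (@getPex _ [set E | l = E - e * sin E]).
have es x : - 1 <= e * sin x <= 1.
  by rewrite -ler_norml normrM ger0_norm// mulr_ile1// sin_max.
have lE : l - 1 <= l + 1 by lra.
have cf : {within `[l - 1, l + 1], continuous (fun x => x - e * sin x)}.
  apply: continuous_subspaceT => x; apply: cvgB; first exact: cvg_id.
  by apply: cvgMr; exact: continuous_sin.
have [|E _ EE] := IVT lE cf (v := l).
  by have := es (l - 1); have := es (l + 1); rewrite ge_min le_max; lra.
by exists E.
Qed.

(** The sine vanishes at [pi] and [- pi] and is 1-Lipschitz, so a root beyond either endpoint would
    force [l] to be there as well. *)
Lemma eccentric_anomaly_itv (e l : R) : 0 <= e < 1 -> -pi < l < pi ->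
  -pi < eccentric_anomaly e l < pi.
Proof.
move=> /andP[e0 e1].
have lE := @eccentric_anomalyP e l; rewrite e0 (ltW e1) in lE.
have {lE} := lE isT; set E := eccentric_anomaly e l => lE /andP[l1 l2].
have lip x : sin x = 0 -> `|e * sin E| <= `|E - x|.
  move=> sx; rewrite normrM ger0_norm//.
  have := sin_lipschitz x E; rewrite sx subr0 => h.
  by rewrite (le_trans _ h)// ler_piMl// ltW.
have := lip pi (sinpi R); have := lip (- pi); rewrite sinN sinpi oppr0 => /(_ erefl).
move=> h1 h2; apply/andP; split; rewrite ltNge; apply/negP => hE.
  move: h1; rewrite (ler0_norm (_ : E - - pi <= 0)); last by lra.
  by rewrite ler_norml => /andP[? ?]; lra.
move: h2; rewrite (ger0_norm (_ : 0 <= E - pi)); last by lra.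
by rewrite ler_norml => /andP[? ?]; lra.
Qed.

Lemma continuous_squeeze (T : topologicalType) (h f : T -> R) (x : T) :
  {for x, continuous h} -> h x = 0 -> (forall y, `|f y - f x| <= h y) ->
  {for x, continuous f}.
Proof.
move=> ch hx0 fh; apply/cvgrPdist_lt => e e0.
have /cvgrPdist_lt/(_ e e0) := ch; apply: filterS => y.
rewrite hx0 sub0r normrN distrC => hy.
by rewrite (le_lt_trans (fh y))// (le_lt_trans _ hy)// ler_norm.
Qed.

(* Subtracting Kepler's equation at [x] and at [y] and applying the mean value
   theorem to the sine writes the increment of [E] as a combination of those of
   [l] and [e] with coefficients continuous at [x]. *)
Lemma is_diff_kepler (V : normedModType R) (l e E dl de : V -> R) (x : V) :
  (forall y, l y = E y - e y * sin (E y)) -> 0 <= e x < 1 ->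
  is_diff x l dl -> is_diff x e de ->
  is_diff x E (fun v => (dl v + sin (E x) * de v) / (1 - e x * cos (E x))).
Proof.
move=> keq /andP[e0 e1] hl he.
have [xi xiE sinE] : exists2 xi : V -> R,
    (forall y, `|xi y - E x| <= `|E y - E x|) &
    forall y, sin (E y) - sin (E x) = cos (xi y) * (E y - E x).
  have /choice[xi H] : forall y, exists t, `|t - E x| <= `|E y - E x| /\
      sin (E y) - sin (E x) = cos t * (E y - E x).
    by move=> y; have [t ? ?] := sin_MVT (E x) (E y); exists t.
  by exists xi => y; have [] := H y.
have N0 t : 0 < 1 - e x * cos t.
  by rewrite subr_gt0 (le_lt_trans _ e1)// ler_piMr// cos_le1.
have incr y : E y - E x =
    (1 - e x * cos (xi y))^-1 * (l y - l x)
    + sin (E y) / (1 - e x * cos (xi y)) * (e y - e x).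
  have Nn0 : 1 - e x * cos (xi y) != 0 by rewrite gt_eqF.
  apply: (mulfI Nn0).
  rewrite [RHS](_ : _ = l y - l x + sin (E y) * (e y - e x)); last by field.
  have -> : (1 - e x * cos (xi y)) * (E y - E x)
      = E y - E x - e x * (cos (xi y) * (E y - E x)).
    by ring.
  by rewrite -sinE !keq; ring.
have cl : {for x, continuous l} by apply: differentiable_continuous; case: hl.
have ce : {for x, continuous e} by apply: differentiable_continuous; case: he.
have cdist (f : V -> R) : {for x, continuous f} ->
    {for x, continuous (fun y => `|f y - f x|)}.
  move=> cf; apply: (@continuous_comp _ _ _ (fun y => f y - f x) Num.norm).
    by apply: cvgB => //; exact: cvg_cst.
  exact: norm_continuous.
(* Continuity of [E] must precede that of the coefficients. It follows from [incr], whose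
   denominators stay at least [1 - e x] wherever [xi y] lies. *)
have cE : {for x, continuous E}.
  apply: (continuous_squeeze (h := fun y =>
      (1 - e x)^-1 * (`|l y - l x| + `|e y - e x|))).
  - by apply: cvgMr; apply: cvgD; exact: cdist.
  - by rewrite !subrr normr0 addr0 mulr0.
  - move=> y; rewrite incr [X in _ + X]mulrAC [X in _ + X]mulrC -mulrDr normrM.
    have Ny := N0 (xi y); rewrite normfV (gtr0_norm Ny).
    apply: ler_pM; rewrite ?invr_ge0 ?(ltW Ny)//.
      by rewrite lef_pV2 ?posrE ?Ny ?subr_gt0// lerD2l lerN2 ler_piMr// cos_le1.
    by apply: (le_trans (ler_normD _ _)); rewrite lerD2l normrM ler_piMl// sin_max.
have xix : xi x = E x.
  by apply/eqP; rewrite -subr_eq0 -normr_le0 (le_trans (xiE x))// subrr normr0.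
have cxi : {for x, continuous xi}.
  apply: (continuous_squeeze (h := fun y => `|E y - E x|)).
  - exact: cdist.
  - by rewrite subrr normr0.
  - by move=> y; rewrite xix.
have c1 : {for x, continuous (fun y => (1 - e x * cos (xi y))^-1)}.
  apply: cvgV; first by rewrite gt_eqF.
  apply: cvgB; first exact: cvg_cst.
  by apply: cvgMr; apply: continuous_comp => //; exact: continuous_cos.
have c2 : {for x, continuous (fun y => sin (E y) / (1 - e x * cos (xi y)))}.
  by apply: cvgM => //; apply: continuous_comp => //; exact: continuous_sin.
apply: (is_diff_ext (is_diff_fctD (is_diff_fct_cst (E x) x)
  (is_diff_fctD (is_diff_increment c1 hl) (is_diff_increment c2 he)))) => [y|v].
  by rewrite -incr addrC subrK.
by rewrite /= xix add0r; ring.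
Qed.

End Kepler.

(** * Delaunay variables *)

(** All differentials are expressed through [dL], [de], [dE] and [dg]; what remains is an algebraic
    identity modulo the two Pythagorean relations. *)
Lemma delaunay_wedge (F : fieldType) (V : Type) (gamma L e eta s c : F)
    (dl dg dL dG de df drho dP : V -> F) (v w : V) :
  let N := 1 - e * c in let a := L ^+ 2 / gamma in
  gamma != 0 -> L != 0 -> e != 0 -> eta != 0 -> N != 0 ->
  eta ^+ 2 = 1 - e ^+ 2 -> s ^+ 2 = 1 - c ^+ 2 ->
  (forall x, de x = - (eta / (e * L)) * (dG x - eta * dL x)) ->
  let dE x := (dl x + s * de x) / N in
  (forall x, df x = (eta * dE x + s / eta * de x) / N) ->
  (forall x, drho x = 2 * L / gamma * N * dL x
                      + a * (e * s * dE x - c * de x)) ->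
  (forall x, dP x = (e * s * dL x + L * s * de x + L * e * c * dE x
                     - L * e * s / (a * N) * drho x) / (a * N)) ->
  (dP v * drho w - dP w * drho v) + (dG v * (dg w + df w) - dG w * (dg v + df v))
  = (dL v * dl w - dL w * dl v) + (dG v * dg w - dG w * dg v).
Proof.
move=> N a gamma0 L0 e0 eta0 N0 etaE sE deE dE dfE drhoE dPE.
have dGE x : dG x = eta * dL x - L * e / eta * de x.
  by rewrite deE; field; rewrite e0 L0 eta0.
have dlE x : dl x = N * dE x - s * de x by rewrite /dE; field.
have a0 : a != 0 by rewrite mulf_neq0 ?invr_eq0 ?expf_neq0.
(* The multiple of [drho] inside [dP] cancels in its wedge product with [drho]. *)
have -> : dP v * drho w - dP w * drho v =
   ((e * s * dL v + L * s * de v + L * e * c * dE v) * drho w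
    - (e * s * dL w + L * s * de w + L * e * c * dE w) * drho v) / (a * N).
  by rewrite !dPE; field; rewrite ?a0 ?gamma0 ?L0 ?N0.
rewrite !dfE !drhoE !dGE !dlE.
move: (dE v) (dE w) (de v) (de w) (dL v) (dL w) (dg v) (dg w).
rewrite /a /N => Ev Ew ev ew Lv Lw gv gw.
by field: etaE sE; rewrite ?gamma0 ?L0 ?eta0 ?N0.
Qed.

Section Delaunay.
Context {R : realType}.

Definition delaunay_e (d : phase R) : R :=
  Num.sqrt (1 - (mom d 2 / mom d 0) ^+ 2).
Definition delaunay_E (d : phase R) : R :=
  eccentric_anomaly (delaunay_e d) (pos d 0).
(** The true anomaly on its principal branch, between [- pi] and [pi], which keeps [cos (f / 2)]
    nonzero. *)
Definition delaunay_f (d : phase R) : R :=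
  2 * atan (Num.sqrt ((1 + delaunay_e d) / (1 - delaunay_e d))
            * tan (delaunay_E d * 2^-1)).
Definition delaunay_rho (gamma : R) (d : phase R) : R :=
  mom d 0 ^+ 2 / gamma * (1 - delaunay_e d * cos (delaunay_E d)).

Definition delaunay_lift (gamma : R) (d : phase R) : phase R :=
  (row4 (delaunay_rho gamma d) (pos d 1) (pos d 2 + delaunay_f d) (pos d 3),
   row4 (mom d 0 * delaunay_e d * sin (delaunay_E d) / delaunay_rho gamma d)
        (mom d 1) (mom d 2) (mom d 3)).

(** Valid at every [d], since the square root of a negative number is 0. Kepler's equation therefore
    holds at every point, as [is_diff_kepler] demands. *)
Lemma delaunay_e_itv (d : phase R) : 0 <= delaunay_e d <= 1.
Proof.
rewrite sqrtr_ge0/= -[leRHS]sqrtr1 ler_sqrt ?ltr01//.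
by rewrite gerBl sqr_ge0.
Qed.

Lemma delaunay_kepler (d : phase R) :
  pos d 0 = delaunay_E d - delaunay_e d * sin (delaunay_E d).
Proof. exact/eccentric_anomalyP/delaunay_e_itv. Qed.

Lemma delaunay_domainP (d : phase R) : delaunay_domain d ->
  [/\ 0 < mom d 0, 0 < mom d 2 / mom d 0, 0 < delaunay_e d < 1,
      (mom d 2 / mom d 0) ^+ 2 = 1 - delaunay_e d ^+ 2
    & -pi < delaunay_E d < pi].
Proof.
move=> [l1 /andP[G0 GL]].
have L0 := lt_trans G0 GL.
have eta0 : 0 < mom d 2 / mom d 0 by rewrite divr_gt0.
have eta1 : (mom d 2 / mom d 0) ^+ 2 < 1.
  by rewrite expr_lt1// ?ltr_pdivrMr ?mul1r// ltW.
have e2 : delaunay_e d ^+ 2 = 1 - (mom d 2 / mom d 0) ^+ 2.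
  by rewrite sqr_sqrtr// subr_ge0 ltW.
have e0 : 0 < delaunay_e d by rewrite sqrtr_gt0 subr_gt0.
have e1 : delaunay_e d < 1.
  by rewrite -(@expr_lt1 _ 2)// ?ltW// e2 ltrBlDr ltrDl exprn_gt0.
split=> //; first by rewrite e0.
  by rewrite e2; ring.
by apply: eccentric_anomaly_itv; rewrite ?e1 ?ltW.
Qed.

Lemma cos_half_gt0 (E : R) : -pi < E < pi -> 0 < cos (E / 2).
Proof.
by move=> /andP[? ?]; apply: cos_gt0_pihalf; apply/andP; split; lra.
Qed.

Lemma delaunay_lift_rel gamma (d : phase R) : delaunay_domain d ->
  delaunay gamma d (delaunay_lift gamma d).
Proof.
move=> dD; have [L0 eta0 e01 etaE E1] := delaunay_domainP dD.
case: dD => l1 G01.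
rewrite /delaunay /delaunay_lift /pos /mom /= !row4E.
split=> //; exists (delaunay_f d), (delaunay_E d); split=> //.
  exact: delaunay_kepler.
have fE : delaunay_f d / 2 = atan (Num.sqrt ((1 + delaunay_e d) / (1 - delaunay_e d))
            * tan (delaunay_E d * 2^-1)).
  by rewrite /delaunay_f mulrC mulKf.
split.
- by rewrite gt_eqF// cos_half_gt0.
- by rewrite fE cos_atan invr_eq0 gt_eqF// sqrtr_gt0 ltr_wpDr// sqr_ge0.
- by rewrite fE atanK.
Qed.

Lemma delaunay_lift_symplectic gamma : 0 < gamma ->
  symplectic_on (@delaunay_domain R) (delaunay_lift gamma).
Proof.
move=> gamma0 d dD; have [L0 eta0 /andP[e0 e1] etaE E1] := delaunay_domainP dD.
have hpos := is_diff_pos d; have hmom := is_diff_mom d.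
have Ln0 : mom d 0 != 0 by rewrite gt_eqF.
have en0 : delaunay_e d != 0 by rewrite gt_eqF.
have eta2 : 1 - (mom d 2 / mom d 0) ^+ 2 = delaunay_e d ^+ 2.
  by rewrite etaE; ring.
pose eta := mom d 2 / mom d 0.
pose de v := - (eta / (delaunay_e d * mom d 0)) * (mom v 2 - eta * mom v 0).
have he : is_diff d delaunay_e de.
  have heta := is_diff_fctM (hmom 2) (is_diff_fctV (hmom 0) Ln0).
  have /is_diff_sqrt H := is_diff_fctD (is_diff_fct_cst 1 d)
    (is_diff_fctN (is_diff_fctM heta heta)).
  apply: (is_diff_ext (H _)) => [|v|v].
  - by rewrite -expr2 eta2 exprn_gt0.
  - by rewrite -expr2.
  - rewrite -expr2 -/(delaunay_e d) /de /eta; field; by rewrite en0 Ln0.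
have hE := is_diff_kepler delaunay_kepler (introT andP (conj (ltW e0) e1))
  (hpos 0) he.
set dE := (X in is_diff d delaunay_E X) in hE.
set e := delaunay_e d in e0 e1 etaE en0 eta2 de he dE hE *.
set E := delaunay_E d in E1 dE hE *.
pose s := sin E; pose c := cos E; pose N := 1 - e * c.
have N0 : 0 < N by rewrite subr_gt0 (le_lt_trans _ e1)// ler_piMr ?cos_le1// ltW.
have ch0 := cos_half_gt0 E1.
pose df v := (eta * dE v + s / eta * de v) / N.
have hf : is_diff d delaunay_f df.
  have e10 : 1 - e != 0 by rewrite gt_eqF// subr_gt0.
  have hq := is_diff_fctM (is_diff_fctD (is_diff_fct_cst 1 d) he)
    (is_diff_fctV (is_diff_fctD (is_diff_fct_cst 1 d) (is_diff_fctN he)) e10).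
  have q0 : 0 < (1 + e) / (1 - e) by rewrite divr_gt0 ?subr_gt0// ltr_wpDl// ltW.
  have ht := is_diff_fct_comp (is_diff_fctM hE (is_diff_fct_cst 2^-1 d))
    (is_derive_tan (lt0r_neq0 ch0)).
  have hkt := is_diff_fctM (is_diff_sqrt hq q0) ht.
  have hatan := is_diff_fctM (is_diff_fct_cst 2 d)
    (is_diff_fct_comp hkt (is_derive1_atan _)).
  apply: (is_diff_ext hatan) => // v.
  (* As [eta ^+ 2 = (1 - e) * (1 + e)], the square root is rational in [eta] and [e]. *)
  have -> : Num.sqrt ((1 + delaunay_e d) / (1 - delaunay_e d)) = eta / (1 - e).
    have e11 : 0 < 1 - e by rewrite subr_gt0.
    have -> : (1 + delaunay_e d) / (1 - delaunay_e d) = (eta / (1 - e)) ^+ 2.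
      by rewrite [RHS]exprMn etaE -/e; field.
    by rewrite sqrtr_sqr gtr0_norm// divr_gt0.
  rewrite -/e -/E /df /N /s /c.
  move: ch0 N0; rewrite /N /c; have -> : E = E / 2 + E / 2 by lra.
  have -> : (E / 2 + E / 2) / 2 = E / 2 by lra.
  rewrite sinD cosD /tan; have := cos2Dsin2 (E / 2).
  move: (dE v) (de v) (cos (E / 2)) (sin (E / 2)) => x y ch sh chsh ch0' N0'.
  have sh2 : sh ^+ 2 = 1 - ch ^+ 2 by rewrite -chsh; ring.
  have chn0 : ch != 0 by rewrite gt_eqF.
  have Nn0 : 1 - e * (ch * ch - sh * sh) != 0 by rewrite gt_eqF.
  have etan0 : eta != 0 by rewrite gt_eqF.
  have etaE' : eta ^+ 2 = 1 - e ^+ 2 by [].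
  clearbody eta.
  (* This is [1 + tan (f / 2) ^+ 2], the denominator coming from the derivative of the arc tangent;
     it supplies the factor [N] in [df]. *)
  have -> : 1 + (eta / (1 - e) * (sh / ch)) ^+ 2
      = (1 - e * (ch * ch - sh * sh)) / ((1 - e) * ch ^+ 2).
    by field: etaE' sh2; rewrite e10 chn0.
  by field: etaE' sh2; rewrite e10 chn0 Nn0 etan0.
have hrho : is_diff d (delaunay_rho gamma) (fun v => 2 * mom d 0 / gamma * N * mom v 0
   + mom d 0 ^+ 2 / gamma * (e * s * dE v - c * de v)).
  apply: (is_diff_ext (is_diff_fctM (is_diff_fctM (is_diff_fctM (hmom 0) (hmom 0))
    (is_diff_fct_cst gamma^-1 d)) (is_diff_fctD (is_diff_fct_cst 1 d)
      (is_diff_fctN (is_diff_fctM he (is_diff_cos hE)))))) => v.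
    by rewrite -expr2.
  by rewrite -/e -/E -/s -/c /N; ring.
have rhoE : delaunay_rho gamma d = mom d 0 ^+ 2 / gamma * N by [].
have rho0 : delaunay_rho gamma d != 0.
  by rewrite rhoE !mulf_neq0 ?invr_eq0 ?expf_neq0 ?gt_eqF.
have hP := is_diff_fctM (is_diff_fctM (is_diff_fctM (hmom 0) he) (is_diff_sin hE))
  (is_diff_fctV hrho rho0).
apply: (symplectic_row4 hrho (hpos 1) (is_diff_fctD (hpos 2) hf) (hpos 3)
  hP (hmom 1) (hmom 2) (hmom 3)) => v w.
have gamman0 : gamma != 0 by rewrite gt_eqF.
have etan0 : eta != 0 by rewrite gt_eqF.
have Nn0 : N != 0 by rewrite gt_eqF.
have sE : s ^+ 2 = 1 - c ^+ 2 by exact: sin2cos2.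
set dP := (X in wedge X _ _ _ + _ + _ + _).
have dPE x : dP x = (e * s * mom x 0 + mom d 0 * s * de x + mom d 0 * e * c * dE x
    - mom d 0 * e * s / (mom d 0 ^+ 2 / gamma * N)
      * (2 * mom d 0 / gamma * N * mom x 0
         + mom d 0 ^+ 2 / gamma * (e * s * dE x - c * de x)))
    / (mom d 0 ^+ 2 / gamma * N).
  rewrite /dP rhoE -/e -/E -/s -/c.
  by field; rewrite gamman0 Ln0 Nn0.
have W := delaunay_wedge (fun x => pos x 2) v w gamman0 Ln0 en0 etan0 Nn0 etaE sE
  (fun=> erefl) (fun=> erefl) (fun=> erefl) dPE.
rewrite sympl_formE /wedge [X in X + _ = _]addrAC.
rewrite [X in X + _ + _ = _](etrans _ W)//.
by ring.
Qed.

End Delaunay.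

(** * Energy *)

Section Energy.
Context {R : realType}.

(** Derived from the defining relations alone, so it applies to every realization of the Euler
    variables. *)
Lemma euler_energy (x c : phase R) : projective_euler x c ->
  let rho := pos x 0 in let theta := pos x 2 in
  let Phi := mom x 1 in let Psi := mom x 3 in
  \sum_(i < 4) pos c i ^+ 2 = rho /\
  \sum_(i < 4) mom c i ^+ 2 = 4 * rho * mom x 0 ^+ 2 + 4 / rho * (mom x 2 ^+ 2
    + (Phi ^+ 2 + Psi ^+ 2 - 2 * Phi * Psi * cos theta) / sin theta ^+ 2).
Proof.
move=> [[rho0 _ theta0 _] cE form] rho theta Phi Psi.
have r0 : 0 < Num.sqrt rho by rewrite sqrtr_gt0.
have rE : rho = Num.sqrt rho ^+ 2 by rewrite sqr_sqrtr// ltW.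
have [s0 c0] := half_angle_gt0 theta0; split.
  have normE (r a : R) : (r * cos a) ^+ 2 + (r * sin a) ^+ 2 = r ^+ 2.
    by rewrite -[RHS](mul_cos2Dsin2 a); ring.
  rewrite sum4E /pos cE /euler_point !row4E normE -addrA.
  by rewrite [X in _ + X]addrC normE addrC normE -rE.
have /(euler_oneformE _ _ rho0)[] := form.
rewrite -/(pos x 2) -/(mom c 0) -/(mom c 1) -/(mom c 2) -/(mom c 3).
set s := sin (_ / 2) in s0 *; set c' := cos (_ / 2) in c0 *.
have cs : c' ^+ 2 = 1 - s ^+ 2 by exact: cos2sin2.
have cosE : cos theta = 1 - 2 * s ^+ 2.
  have -> : theta = theta / 2 + theta / 2 by lra.
  by rewrite cosD -/s -/c' -!expr2 cs; ring.
have sinE : sin theta = 2 * s * c'.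
  have -> : theta = theta / 2 + theta / 2 by lra.
  by rewrite sinD -/s -/c'; ring.
set c1 := cos _; set s1 := sin ((_ - _) / 2); set c2 := cos ((_ + _) / 2).
set s2 := sin _.
rewrite sum4E.
have r1E : Num.sqrt (x.1 0 0) = Num.sqrt rho by [].
rewrite r1E; move: r0 rE; set r := Num.sqrt rho => r0 rE.
move: (mom c 0) (mom c 1) (mom c 2) (mom c 3) => Q0 Q1 Q2 Q3 H0 H2 H1 H3.
have HB : c' * (Q0 * c1 + Q1 * s1) - s * (Q2 * s2 + Q3 * c2) = 2 * mom x 2 / r.
  by rewrite -H2 [RHS]mulrC mulKf ?gt_eqF.
have HC : Q1 * c1 - Q0 * s1 = (Phi - Psi) / (r * s).
  by rewrite -H1 [RHS]mulrC mulKf ?mulf_neq0 ?gt_eqF.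
have HD : Q2 * c2 - Q3 * s2 = (Phi + Psi) / (r * c').
  by rewrite -H3 [RHS]mulrC mulKf ?mulf_neq0 ?gt_eqF.
(* Three rotations preserve the sum of squares: one in each plane, to radial and tangential
   components, and one by [theta / 2] mixing the two radial components. *)
have -> : Q0 ^+ 2 + Q1 ^+ 2 + Q2 ^+ 2 + Q3 ^+ 2 =
    (2 * r * mom x 0) ^+ 2 + (2 * mom x 2 / r) ^+ 2
    + ((Phi - Psi) / (r * s)) ^+ 2 + ((Phi + Psi) / (r * c')) ^+ 2.
  rewrite -H0 -HB -HC -HD.
  have c1E : c1 ^+ 2 = 1 - s1 ^+ 2 by exact: cos2sin2.
  have c2E : c2 ^+ 2 = 1 - s2 ^+ 2 by exact: cos2sin2.
  by ring: cs c1E c2E.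
rewrite cosE sinE rE.
field: cs; by rewrite !gt_eqF.
Qed.

(** Squaring the formula for [Theta] suffices once its radicand is known to be nonnegative; the law
    of cosines exhibits that radicand as a square. *)
Lemma andoyer_momentum (y x : phase R) : projective_andoyer y x ->
  let theta := pos x 2 in let Phi := mom x 1 in let Psi := mom x 3 in
  mom x 2 ^+ 2 + (Phi ^+ 2 + Psi ^+ 2 - 2 * Phi * Psi * cos theta) / sin theta ^+ 2
  = mom y 2 ^+ 2.
Proof.
move=> [[_ theta0 U1 U3] _ [cosE _ _] [PhiE PsiE ThetaE]] theta Phi Psi.
have U2 : 0 < mom y 2 by exact: le_lt_trans U1.
have sin0 : 0 < sin theta by exact: sin_gt0_pi.
have ratio (u : R) : `|u| < mom y 2 -> 0 <= 1 - (u / mom y 2) ^+ 2.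
  move=> uU; rewrite subr_ge0 -real_normK ?num_real// expr_le1//.
  by rewrite normrM normfV (gtr0_norm U2) ler_pdivrMr// mul1r ltW.
have s1E : Num.sqrt (1 - (mom y 1 / mom y 2) ^+ 2) ^+ 2 = 1 - (mom y 1 / mom y 2) ^+ 2.
  by rewrite sqr_sqrtr// ratio.
have s2E : Num.sqrt (1 - (mom y 3 / mom y 2) ^+ 2) ^+ 2 = 1 - (mom y 3 / mom y 2) ^+ 2.
  by rewrite sqr_sqrtr// ratio.
have suE : sin (pos y 2) ^+ 2 = 1 - cos (pos y 2) ^+ 2 by exact: sin2cos2.
have sE : sin theta ^+ 2 = 1 - cos theta ^+ 2 by exact: sin2cos2.
rewrite /Phi /Psi PhiE PsiE ThetaE exprMn sqr_sqrtr -/theta.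
  by field; rewrite !gt_eqF.
move: cosE s1E s2E; set c1 := mom y 1 / mom y 2; set c2 := mom y 3 / mom y 2.
set s1 := Num.sqrt (1 - c1 ^+ 2); set s2 := Num.sqrt (1 - c2 ^+ 2).
move=> cosE s1E s2E; clearbody s1 s2; clearbody c1 c2.
have -> : 1 - (c1 ^+ 2 + c2 ^+ 2 - 2 * c1 * c2 * cos theta) / sin theta ^+ 2
  = (s1 * s2 * sin (pos y 2) / sin theta) ^+ 2; last exact: sqr_ge0.
rewrite !(exprMn, exprVn) s1E s2E suE.
apply: (mulIf (x := sin theta ^+ 2)); first by rewrite expf_neq0// gt_eqF.
rewrite divfK ?expf_neq0 ?gt_eqF// mulrBl mul1r divfK ?expf_neq0 ?gt_eqF//.
rewrite sE cosE.
by ring: s1E s2E.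
Qed.

(** The energy of a Kepler ellipse is [- gamma / (2 * a)], with [a = L ^+ 2 / gamma]. The bound
    [e < 1] keeps the radius away from 0. *)
Lemma kepler_energy (gamma : R) (d y : phase R) : 0 < gamma ->
  delaunay gamma d y ->
  mom y 0 ^+ 2 / 2 + mom y 2 ^+ 2 / (2 * pos y 0 ^+ 2) - gamma / pos y 0
  = kepler_delaunay gamma d.
Proof.
move=> gamma0 [/andP[G0 GL] _ [f [E [_ _ [_ ->] [-> ->]]]]].
rewrite /kepler_delaunay.
have L0 := lt_trans G0 GL.
have eta0 : 0 < mom d 2 / mom d 0 by rewrite divr_gt0.
have eta1 : mom d 2 / mom d 0 < 1 by rewrite ltr_pdivrMr// mul1r.
have e2 : Num.sqrt (1 - (mom d 2 / mom d 0) ^+ 2) ^+ 2 = 1 - (mom d 2 / mom d 0) ^+ 2.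
  by rewrite sqr_sqrtr// subr_ge0 expr_le1// ltW.
have e0 := sqrtr_ge0 (1 - (mom d 2 / mom d 0) ^+ 2).
have e1 : Num.sqrt (1 - (mom d 2 / mom d 0) ^+ 2) < 1.
  by rewrite -(ltr_pXn2r (n := 2))// ?nnegrE// expr1n e2 ltrBlDr ltrDl exprn_gt0.
move: e2 e0 e1; set e := Num.sqrt _ => e2 e0 e1.
have N0 : 1 - e * cos E != 0.
  rewrite gt_eqF// subr_gt0 (le_lt_trans _ e1)// ler_piMr//; exact: cos_le1.
have G2 : mom d 2 ^+ 2 = mom d 0 ^+ 2 * (1 - e ^+ 2).
  by rewrite e2; field; rewrite gt_eqF.
have sE : sin E ^+ 2 = 1 - cos E ^+ 2 by exact: sin2cos2.
by field: G2 sE; rewrite N0 !gt_eqF.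
Qed.

End Energy.

(** * Composition *)

Section Composition.
Context {R : realType}.
Implicit Types F G : phase R -> phase R.

(** [F] is controlled only on [D], so the preimage is intersected with [D] and openness is checked
    point by point. *)
Lemma open_preimage_on (D U : set (phase R)) F : open D -> open U ->
  (forall x, D x -> differentiable F x) -> open [set x | D x /\ U (F x)].
Proof.
move=> oD oU dF; rewrite openE => x [Dx UFx].
have cF := differentiable_continuous (dF x Dx).
have DU : nbhs x (D `&` F @^-1` U).
  apply: filterI; first exact: open_nbhs_nbhs.
  by apply: cF; exact: open_nbhs_nbhs.
by apply: filterS DU => z [].
Qed.

Lemma symplectic_on_comp (D : set (phase R)) F G : symplectic_on D F ->
  (forall x, D x -> differentiable G (F x) /\
     forall v w, sympl_form ('d G (F x) v) ('d G (F x) w) = sympl_form v w) ->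
  symplectic_on D (G \o F).
Proof.
move=> sF sG x Dx; have [dF SF] := sF x Dx; have [dG SG] := sG x Dx.
split; first exact: differentiable_comp.
by move=> v w; have -> := diff_comp dF dG; rewrite /= SG SF.
Qed.

End Composition.

(** * Openness of the domains and a point where the composition is defined *)

Section Domains.
Context {R : realType}.

Lemma open_euler_domain : open (@euler_domain R).
Proof.
rewrite (_ : @euler_domain R = ([set x | 0 < pos x 0] `&`
   ([set x | 0 < pos x 1] `&` [set x | pos x 1 < 2 * pi])) `&`
   (([set x | 0 < pos x 2] `&` [set x | pos x 2 < pi]) `&`
    ([set x | - (pi / 2) < pos x 3] `&` [set x | pos x 3 < pi / 2]))).
  by do ![apply: openI]; apply: open_lt_fun;
    (exact: pos_continuous || exact: cst_continuous).
apply/seteqP; split => x /=.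
  by move=> [? /andP[? ?] /andP[? ?] /andP[? ?]].
by move=> [[? [? ?]] [[? ?] [? ?]]]; split=> //; apply/andP.
Qed.

Lemma open_andoyer_domain : open (@andoyer_domain R).
Proof.
have cnorm i : continuous (fun x : phase R => `|mom x i|).
  move=> x; apply: (@continuous_comp _ _ _ (fun y : phase R => mom y i) Num.norm).
    exact: mom_continuous.
  exact: norm_continuous.
have csin : continuous (fun x : phase R => sin (pos x 2)).
  move=> x; apply: (@continuous_comp _ _ _ (fun y : phase R => pos y 2) sin).
    exact: pos_continuous.
  exact: continuous_sin.
rewrite (_ : @andoyer_domain R = ([set x | 0 < pos x 0] `&`
   [set x | `|mom x 1| < mom x 2]) `&` ([set x | `|mom x 3| < mom x 2] `&`
    [set x | 0 < sin (pos x 2)])).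
  by do ![apply: openI]; apply: open_lt_fun => //;
    (exact: pos_continuous || exact: mom_continuous || exact: cst_continuous).
apply/seteqP; split => x /=; first by case.
by move=> [[? ?] [? ?]].
Qed.

Lemma open_delaunay_domain : open (@delaunay_domain R).
Proof.
rewrite (_ : @delaunay_domain R = ([set x | - pi < pos x 0] `&`
   [set x | pos x 0 < pi]) `&` ([set x | 0 < mom x 2] `&`
    [set x | mom x 2 < mom x 0])).
  by do ![apply: openI]; apply: open_lt_fun => //;
    (exact: pos_continuous || exact: mom_continuous || exact: cst_continuous).
apply/seteqP; split => x /=; first by move=> [/andP[? ?] /andP[? ?]].
by move=> [[? ?] [? ?]]; split; apply/andP.
Qed.

Lemma andoyer_alpha_beta0 (y : phase R) : mom y 1 = 0 -> mom y 3 = 0 ->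
  andoyer_alpha y = pi / 2 /\ andoyer_beta y = pi / 2.
Proof.
move=> U1 U3; rewrite /andoyer_alpha /andoyer_beta.
have -> : andoyer_c1 y = 0 by rewrite /andoyer_c1 U1 mul0r.
have -> : andoyer_c2 y = 0 by rewrite /andoyer_c2 U3 mul0r.
by rewrite !(mul0r, mulr0) subrr mul0r acos0.
Qed.

Lemma lift_domain_nonempty (gamma : R) : 0 < gamma ->
  comp_domain (@euler_domain R) (@andoyer_domain R) (@delaunay_domain R)
    andoyer_lift (delaunay_lift gamma) !=set0.
Proof.
move=> gamma0.
(* The true anomaly depends only on [l], [L] and [G], so it can be computed before [g] is fixed. The
   choice [g = pi / 2 - f0] makes [u2 = pi / 2]; with [U1 = U3 = 0] both [alpha] and [beta] are
   [pi / 2], so [u1 = - (pi / 2)] and [u3 = 0] give [psi = 0] and [phi = pi / 2]. *)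
pose f0 := delaunay_f (row4 0 0 0 0, row4 2 0 1 0 : 'rV[R]_4).
pose d : phase R := (row4 0 (- (pi / 2)) (pi / 2 - f0) 0, row4 2 0 1 0).
have pi0 : 0 < pi :> R by exact: pi_gt0.
have fE : delaunay_f d = f0.
  by rewrite /f0 /delaunay_f /delaunay_E /delaunay_e /d /pos /mom /= !row4E.
have dD : delaunay_domain d.
  rewrite /delaunay_domain /d /pos /mom /= !row4E; split; lra.
have [L0 _ /andP[e0 e1] _ _] := delaunay_domainP dD.
have yD : andoyer_domain (delaunay_lift gamma d).
  rewrite /andoyer_domain /delaunay_lift /pos /mom /= !row4E fE subrK sin_pihalf.
  rewrite normr0; split=> //.
  rewrite /delaunay_rho mulr_gt0 ?divr_gt0 ?exprn_gt0//.
  by rewrite subr_gt0 (le_lt_trans _ e1)// ler_piMr ?cos_le1// ltW.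
exists d; split=> //.
have [[_ theta0 _ _] _ _] := andoyer_angles yD.
have [rho0 _ _ _] := yD.
have [] := @andoyer_alpha_beta0 (delaunay_lift gamma d).
- by rewrite /delaunay_lift /mom /= !row4E.
- by rewrite /delaunay_lift /mom /= !row4E.
move=> aE bE.
set y := delaunay_lift gamma d in yD theta0 rho0 aE bE *.
have u1 : pos y 1 = - (pi / 2) by rewrite /y /delaunay_lift /pos /= !row4E.
have u3 : pos y 3 = 0 by rewrite /y /delaunay_lift /pos /= !row4E.
have E0 : pos (andoyer_lift y) 0 = pos y 0 by rewrite /pos row4E.
have E1 : pos (andoyer_lift y) 1 = pos y 3 + andoyer_beta y.
  by rewrite /pos row4E.
have E2 : pos (andoyer_lift y) 2 = andoyer_theta y by rewrite /pos row4E.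
have E3 : pos (andoyer_lift y) 3 = pos y 1 + andoyer_alpha y.
  by rewrite /pos row4E.
rewrite /euler_domain /= E0 E1 E2 E3 aE bE u1 u3.
by split=> //; lra.
Qed.

End Domains.

(** The first half shows that the second is not vacuous; the second concerns arbitrary realizations
    of the relations. The potential [omega ^+ 2 * rho / 2] divided by [4 * rho] leaves the constant
    [omega ^+ 2 / 8], hence the level [- (omega ^+ 2 / 8)]. *)
Theorem theorem3p3 (R : realType) (omega h gamma : R)
    (omega_gt0 : 0 < omega) (h_gt0 : 0 < h) (gammaE : gamma = h / 4) :
  (exists TE TA TD : phase R -> phase R,
     [/\ symplectic_transformation (@projective_euler R) (@euler_domain R) TE,
         symplectic_transformation
           (@projective_andoyer R) (@andoyer_domain R) TA,
         symplectic_transformation (@delaunay R gamma) (@delaunay_domain R) TD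
       & comp_domain (@euler_domain R) (@andoyer_domain R)
           (@delaunay_domain R) TA TD !=set0])
  /\
  (forall (DE DA DD : set (phase R)) (TE TA TD : phase R -> phase R),
     symplectic_transformation (@projective_euler R) DE TE ->
     symplectic_transformation (@projective_andoyer R) DA TA ->
     symplectic_transformation (@delaunay R gamma) DD TD ->
     let T := TE \o TA \o TD in
     let D := comp_domain DE DA DD TA TD in
     let H2 := fun d : phase R => isotropic_oscillator omega (T d) in
     let rho := fun d : phase R => pos (TD d) 0 in
     [/\ open D, symplectic_on D T
       & forall d, D d ->
           regularized H2 rho h d = kepler_delaunay gamma d + omega ^+ 2 / 8 /\
           (H2 d = h <-> kepler_delaunay gamma d = - (omega ^+ 2 / 8))]).
Proof.
have gamma0 : 0 < gamma by rewrite gammaE divr_gt0.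
split.
  exists euler_lift, andoyer_lift, (delaunay_lift gamma); split.
  - split; [exact: open_euler_domain|exact: euler_lift_rel|].
    exact: euler_lift_symplectic.
  - split; [exact: open_andoyer_domain|exact: andoyer_lift_rel|].
    exact: andoyer_lift_symplectic.
  - split; [exact: open_delaunay_domain| |exact: delaunay_lift_symplectic].
    by move=> d; exact: delaunay_lift_rel.
  - exact: lift_domain_nonempty.
move=> DE DA DD TE TA TD [oE relE sE] [oA relA sA] [oD relD sD] T D H2 rho.
split.
- have oAE : open [set y | DA y /\ DE (TA y)].
    by apply: open_preimage_on => // y /sA[].
  rewrite (_ : D = [set d | DD d /\ (DA (TD d) /\ DE (TA (TD d)))]).
    by apply: open_preimage_on oAE _ => // d /sD[].
  by apply/seteqP; split=> d /=; [case|move=> [? [? ?]]].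
- have sAD : symplectic_on D (TA \o TD).
    apply: (@symplectic_on_comp _ D TD TA); first by move=> d [Dd _ _]; exact: sD.
    by move=> d [_ Ad _]; exact: sA.
  have -> : T = TE \o (TA \o TD) by [].
  apply: (@symplectic_on_comp _ D (TA \o TD) TE); first exact: sAD.
  by move=> d [_ _ Ed]; exact: sE.
move=> d [Dd Ad Ed].
have aE := relE _ Ed; have aA := relA _ Ad; have aD := relD _ Dd.
have [q2 Q2] := euler_energy aE.
have M := andoyer_momentum aA.
have K := kepler_energy gamma0 aD.
case: aA => [[rho0 _ _ _] [rhoE PE] _ _].
rewrite /= M rhoE PE in q2 Q2; rewrite rhoE in rho0.
have rho1 : 4 * rho d != 0 by rewrite mulf_neq0// gt_eqF.
(* Since [gamma = h / 4], subtracting [h] and dividing by [4 * rho] creates the Kepler potential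
   [- gamma / rho]. *)
have HE : regularized H2 rho h d = kepler_delaunay gamma d + omega ^+ 2 / 8.
  rewrite -K /regularized /H2 /isotropic_oscillator q2 Q2 gammaE /rho.
  by field; rewrite gt_eqF.
split=> //.
(* Because [4 * rho] does not vanish, the energy level [h] is the zero level of the regularized
   Hamiltonian. *)
have -> : (H2 d = h) <-> regularized H2 rho h d = 0.
  rewrite /regularized; split=> [->|/eqP]; first by rewrite subrr mul0r.
  by rewrite mulf_eq0 invr_eq0 (negPf rho1) orbF subr_eq0 => /eqP.
rewrite HE; split=> [/eqP|->]; last by rewrite addNr.
by rewrite addr_eq0 => /eqP.
Qed.
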